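(* Let $X$ be a complex Hilbert space with open unit ball $B_X$ and let $Y$ be a complex Banach space. The spaces $\mathcal{B}^\nabla(B_X,Y)$ and $\mathcal{B}^{\rm inv}(B_X,Y)$ coincide. Moreover, there is a constant $C>0$, independent of $f$, such that for all $f$ in this space $$\|f\|_{\mathcal{B}^\nabla(B_X,Y)}\le\|f\|_{\mathcal{B}^{\rm inv}(B_X,Y)}\le C\,\|f\|_{\mathcal{B}^\nabla(B_X,Y)}.$$
   Context: $H(B_X,Y)$ is the space of $Y$-valued holomorphic functions on $B_X$. Fix an orthonormal basis $(e_k)_{k\in\Gamma}$ of $X$. For a scalar holomorphic $h$ on $B_X$, $\nabla h(z)=(\partial h/\partial z_k(z))_{k\in\Gamma}\in X$ is the element with $h'(z)(x)=\langle x,\overline{\nabla h(z)}\rangle$ (with $\overline z=\sum_k\overline{z_k}e_k$). For $f\in H(B_X,Y)$, $\|\nabla f(z)\|=\sup_{u\in Y',\|u\|=1}\|\nabla(u\circ f)(z)\|$. $\mathcal{B}^\nabla(B_X,Y)$ is the set of $f\in H(B_X,Y)$ with $\sup_{z\in B_X}(1-\|z\|^2)\|\nabla f(z)\|<\infty$, with norm $\|f\|_{\mathcal{B}^\nabla(B_X,Y)}=\|f(0)\|+\sup_{z\in B_X}(1-\|z\|^2)\|\nabla f(z)\|$. For $a\in B_X$, $a\ne0$, the Möbius transformation is $\varphi_a(z)=\dfrac{a-P_a(z)-s_aQ_a(z)}{1-\langle z,a\rangle}$, $z\in B_X$, where $s_a=\sqrt{1-\|a\|^2}$, $P_a$ is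 the orthogonal projection of $X$ onto the span of $a$ and $Q_a=I-P_a$; $\varphi_0(z)=-z$. The invariant gradient norm is $\|\widetilde\nabla f(z)\|=\|\nabla(f\circ\varphi_z)(0)\|$. $\mathcal{B}^{\rm inv}(B_X,Y)$ is the set of $f\in H(B_X,Y)$ with $\|f\|_{s\mathcal{B}^{\rm inv}}=\sup_{z\in B_X}\|\widetilde\nabla f(z)\|<\infty$, with norm $\|f\|_{\mathcal{B}^{\rm inv}(B_X,Y)}=\|f(0)\|+\|f\|_{s\mathcal{B}^{\rm inv}}$. *)

(* Defs.v *)
From HB Require Import structures.
From mathcomp Require Import all_boot all_order all_algebra.
From mathcomp Require Import sesquilinear complex.
From mathcomp Require Import all_classical all_reals all_analysis.
From mathcomp Require Import showcase.summability.

Set Implicit Arguments.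
Unset Strict Implicit.
Unset Printing Implicit Defensive.

Import Order.TTheory GRing.Theory Num.Theory.
Import numFieldNormedType.Exports.

Local Open Scope classical_set_scope.
Local Open Scope ring_scope.
Local Open Scope complex_scope.

Section Norms.
Context {R : realType}.

(* The norm of a normed module over R[i] takes its values in R[i], where it is
   a nonnegative real; [nrm] is the same number seen in R. *)
Definition nrm {V : normedModType R[i]} (x : V) : R := complex.Re `|x|.

Definition unit_ball {V : normedModType R[i]} : set V := [set z | nrm z < 1].

Definition dual_norm {V : normedModType R[i]} (u : V -> (R[i])^o) : R :=
  sup [set nrm (u y) | y in [set y : V | nrm y <= 1]].

Definition unit_dual {V : normedModType R[i]} : set {linear V -> (R[i])^o} :=
  [set u | continuous u /\ dual_norm u = 1].

End Norms.

Section Hilbert.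
Context {R : realType} {X : completeNormedModType R[i]}.

(* A complex Hilbert space is a complete normed space X together with an inner
   product (linear in its first argument) that induces the norm of X. *)
Definition induces_norm (ip : {dot X for Num.conj}) : Prop :=
  forall x : X, `|x| ^+ 2 = ip x x.

Definition has_sum {I : choiceType} (x : I -> X) (s : X) : Prop :=
  partial_sum x @ totally --> s.

Definition orthonormal_basis (ip : {dot X for Num.conj}) {I : choiceType}
    (e : I -> X) : Prop :=
  (forall j k, ip (e j) (e k) = (j == k)%:R) /\
  (forall x, has_sum (fun k => ip x (e k) *: e k) x).

Definition proj_line (ip : {dot X for Num.conj}) (a z : X) : X :=
  (ip z a / ip a a) *: a.

Lemma proj_line_orthogonal (ip : {dot X for Num.conj}) (a z : X) : a != 0 ->
  forall c : R[i], ip (z - proj_line ip a z) (c *: a) = 0.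
Proof.
move=> a0 c; have aa0 : ip a a != 0 by rewrite gt_eqF // neq0_dnorm_gt0.
rewrite linearZr_LR /= linearBl linearZl_LR /=.
by rewrite divfK // subrr mulr0.
Qed.

Definition mobius (ip : {dot X for Num.conj}) (a z : X) : X :=
  if a == 0 then - z else
  let s := (Num.sqrt (1 - nrm a ^+ 2))%:C in
  let Pz := proj_line ip a z in
  (1 - ip z a)^-1 *: (a - Pz - s *: (z - Pz)).

End Hilbert.

Section Bloch.
Context {R : realType} {X Y : completeNormedModType R[i]} {I : choiceType}.

(* Functions on the ball are represented by total functions: every notion
   below depends only on their restriction to the open unit ball. *)
Definition holomorphic_on_ball (f : X -> Y) : Prop :=
  forall z, unit_ball z -> differentiable f z.

Variable e : I -> X.

(* The vector with coordinates (dh/dz_k (z))_k in the basis e; the partial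
   derivative dh/dz_k is the complex directional derivative along e k. *)
Definition gradient (h : X -> (R[i])^o) (z : X) : X :=
  sum (fun k => ('D_(e k) h z : R[i]) *: e k).

(* For f differentiable at z the set is bounded, by the operator norm of the
   differential of f at z.  When Y = {0} it is empty and [sup] is 0. *)
Definition gradient_norm (f : X -> Y) (z : X) : R :=
  sup [set nrm (gradient (u \o f) z) | u in @unit_dual R Y].

Definition bloch_values (f : X -> Y) : set R :=
  [set (1 - nrm z ^+ 2) * gradient_norm f z | z in unit_ball].

Definition bloch_nabla : set (X -> Y) :=
  [set f | holomorphic_on_ball f /\ has_ubound (bloch_values f)].

Definition bloch_nabla_norm (f : X -> Y) : R :=
  nrm (f 0) + sup (bloch_values f).

Variable ip : {dot X for Num.conj}.

Definition inv_gradient_norm (f : X -> Y) (z : X) : R :=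
  gradient_norm (f \o mobius ip z) 0.

Definition inv_values (f : X -> Y) : set R :=
  [set inv_gradient_norm f z | z in unit_ball].

Definition bloch_inv : set (X -> Y) :=
  [set f | holomorphic_on_ball f /\ has_ubound (inv_values f)].

Definition bloch_inv_norm (f : X -> Y) : R :=
  nrm (f 0) + sup (inv_values f).

End Bloch.

Arguments bloch_nabla {R X} Y {I} e.
Arguments bloch_inv {R X} Y {I} e ip.

(* Main.v *)
(* For a functional u in the unit sphere of Y', put h = u o f; since ||grad h(z)||
   is the norm of the differential h'(z), everything reduces to scalar h, uniformly
   in u. Let P be the projection onto the line of z, Q = 1 - P, s^2 = 1 - ||z||^2.
   The differential of phi_z at 0 is D = - (s^2 P + s Q), so
   ||grad (h o phi_z)(0)|| = ||h'(z) o D||. The first inequality holds because s^2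
   times the inverse of D is a contraction. For the second, s^2 h'(z) P is bounded
   by the Bloch norm M, and what is needed is the tangential bound
   |h'(z) v| <= C M / s for unit v orthogonal to z.

   With z = (1 - r^2) e, compare h'((1 - r^2) e) v with h'((1 - 4 r^2) e) v. Their
   difference is the derivative at 0 of
   b |-> h((1 - r^2) e + b v) - h((1 - 4 r^2) e + b v),
   which the radial bound on h' makes O(M) on a disc of radius comparable to r; by
   Cauchy's estimate the difference is O(M / r). Doubling r repeatedly and summing
   the geometric series gives O(M / r).

   Cauchy's estimate is needed for functions that are merely complex differentiable.
   It comes from Goursat's bisection argument, run on midpoint sums over the
   boundaries of squares instead of contour integrals: like integrals, these sums
   are exactly additive under subdivision and vanish on affine functions. *)
Require Import Defs.
From HB Require Import structures.
From mathcomp Require Import all_boot all_order all_algebra.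
From mathcomp Require Import sesquilinear complex.
From mathcomp Require Import all_classical all_reals all_analysis.
From mathcomp Require Import showcase.summability.
From mathcomp Require Import finmap ring lra.

Set Implicit Arguments.
Unset Strict Implicit.
Unset Printing Implicit Defensive.

Import Order.TTheory GRing.Theory Num.Theory.
Import numFieldNormedType.Exports.

Local Open Scope classical_set_scope.
Local Open Scope ring_scope.
Local Open Scope complex_scope.

(** * Real-valued norms and first-order expansions *)

Section NormBasics.
Variable R : realType.
Implicit Types (V : normedModType R[i]) (z w : R[i]).

(* Convertible to [nrm] on [R[i]^o], but usable on terms of type [R[i]]. *)
Definition cabs (z : R[i]) : R := complex.Re `|z|.

Lemma normE V (x : V) : `|x| = (nrm x)%:C.
Proof. by rewrite /nrm RRe_real // normr_real. Qed.

Lemma cabsE z : `|z| = (cabs z)%:C.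
Proof. by rewrite /cabs RRe_real // normr_real. Qed.

Lemma nrm_ge0 V (x : V) : 0 <= nrm x.
Proof. by rewrite -lecR -normE normr_ge0. Qed.

Lemma cabs_ge0 z : 0 <= cabs z.
Proof. by rewrite -lecR -cabsE normr_ge0. Qed.

Lemma ler_nrmD V (x y : V) : nrm (x + y) <= nrm x + nrm y.
Proof. by rewrite -lecR rmorphD /= -!normE ler_normD. Qed.

Lemma ler_cabsD z w : cabs (z + w) <= cabs z + cabs w.
Proof. by rewrite -lecR rmorphD /= -!cabsE ler_normD. Qed.

Lemma nrmN V (x : V) : nrm (- x) = nrm x.
Proof. by rewrite /nrm normrN. Qed.

Lemma cabsN z : cabs (- z) = cabs z.
Proof. by rewrite /cabs normrN. Qed.

Lemma nrmZ V z (x : V) : nrm (z *: x) = cabs z * nrm x.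
Proof. by apply: complexI; rewrite rmorphM /= -!normE -cabsE normrZ. Qed.

Lemma cabsM z w : cabs (z * w) = cabs z * cabs w.
Proof. by apply: complexI; rewrite rmorphM /= -!cabsE normrM. Qed.

Lemma nrm0 V : nrm (0 : V) = 0.
Proof. by rewrite /nrm normr0. Qed.

Lemma cabs0 : cabs 0 = 0.
Proof. by rewrite /cabs normr0. Qed.

Lemma nrm_eq0 V (x : V) : (nrm x == 0) = (x == 0).
Proof. by rewrite -[RHS]normr_eq0 normE -(inj_eq (@complexI R)). Qed.

Lemma cabs_eq0 z : (cabs z == 0) = (z == 0).
Proof. by rewrite -[RHS]normr_eq0 cabsE -(inj_eq (@complexI R)). Qed.

Lemma cabs_gt0 z : (0 < cabs z) = (z != 0).
Proof. by rewrite lt0r cabs_eq0 cabs_ge0 andbT. Qed.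

Lemma cabs1 : cabs 1 = 1.
Proof. by rewrite /cabs normr1. Qed.

Lemma cabsV z : cabs z^-1 = (cabs z)^-1.
Proof. by apply: complexI; rewrite fmorphV -!cabsE normfV. Qed.

Lemma cabsX z n : cabs (z ^+ n) = cabs z ^+ n.
Proof. by elim: n => [|n ih]; rewrite ?expr0 ?cabs1 // !exprS cabsM ih. Qed.

Lemma cabs_real (a : R) : cabs a%:C = `|a|.
Proof.
apply: complexI; rewrite -cabsE normc_def /= expr0n /= addr0.
by rewrite sqrtr_sqr.
Qed.

Lemma cabs_i : cabs 'i = 1.
Proof. by rewrite /cabs normc_def /= expr0n /= add0r expr1n sqrtr1. Qed.

Lemma cabs_nat n : cabs n%:R = n%:R.
Proof. by rewrite -(rmorph_nat (real_complex R)) cabs_real normr_nat. Qed.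

Lemma cabs_sqr z : cabs z ^+ 2 = complex.Re z ^+ 2 + complex.Im z ^+ 2.
Proof. by apply: complexI; rewrite rmorphXn /= -cabsE add_Re2_Im2. Qed.

Lemma cabs_ge_Re z : `|complex.Re z| <= cabs z.
Proof. by rewrite -lecR -cabsE normc_ge_Re. Qed.

Lemma cabs_ge_Im z : `|complex.Im z| <= cabs z.
Proof.
by rewrite -(ler_pXn2r (ltn0Sn 1)) ?nnegrE ?cabs_ge0 // cabs_sqr
           real_normK ?num_real // lerDr sqr_ge0.
Qed.

Lemma cabs_conj z : cabs z^* = cabs z.
Proof. by rewrite /cabs norm_conjC. Qed.

Lemma ler_cabsB z w : cabs (z - w) <= cabs z + cabs w.
Proof. by rewrite -(cabsN w) ler_cabsD. Qed.

Lemma cabs_sum (I : Type) (s : seq I) (P : pred I) (F : I -> R[i]) :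
  cabs (\sum_(i <- s | P i) F i) <= \sum_(i <- s | P i) cabs (F i).
Proof.
elim/big_rec2: _ => [|i y x _ h]; first by rewrite cabs0.
by rewrite (le_trans (ler_cabsD _ _)) // lerD2l.
Qed.

Lemma normc_lt V (x : V) (d : R) : (`|x| < d%:C) = (nrm x < d).
Proof. by rewrite normE ltcR. Qed.

(** Comparable elements of [R[i]] have equal imaginary parts, so positive ones are real. This turns
    every epsilon over [R[i]] into a real one. *)
Lemma gt0_complex (e : R[i]) : 0 < e -> exists2 d : R, 0 < d & e = d%:C.
Proof.
by case: e => a b; rewrite ltcE /= => /andP[/eqP -> ha]; exists a.
Qed.

Lemma near_nrm V (x : V) (P : V -> Prop) : (\forall y \near x, P y) <->
  exists2 d : R, 0 < d & forall y, nrm (y - x) < d -> P y.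
Proof.
split.
  move/nbhs_ballP => [e /= /gt0_complex[d d0 ->] h]; exists d => // y yx.
  by apply: h; rewrite -ball_normE /ball_/= distrC normc_lt.
case=> d d0 h; apply/nbhs_ballP; exists d%:C => /=; first by rewrite ltcR.
move=> y; rewrite -ball_normE /ball_/= distrC normc_lt => ?; exact: h.
Qed.

Lemma diff_expansion V (W : normedModType R[i]) (h : V -> W) (w : V) : differentiable h w ->
  forall e, 0 < e -> exists2 d : R, 0 < d &
  forall y, nrm y < d -> nrm (h (w + y) - h w - 'd h w y) <= e * nrm y.
Proof.
move=> dh e e0; have /eqaddoP/(_ e%:C) := diff_locally dh.
rewrite ltcR => /(_ e0)/near_nrm [d d0 hd]; exists d => // y yd.
have := hd y; rewrite subr0 => /(_ yd).
by rewrite !normE -rmorphM lecR /= opprD addrA !fctE /= (addrC y w).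
Qed.

Lemma derivable_expansion (p : R[i]^o -> R[i]^o) (w : R[i]^o) : derivable p w 1 ->
  forall e, 0 < e -> exists2 d : R, 0 < d &
  forall z : R[i]^o, cabs (z - w) < d ->
    cabs (p z - p w - 'D_1 p w * (z - w)) <= e * cabs (z - w).
Proof.
move=> /derivable1_diffP dp e e0.
have [d d0 hd] := diff_expansion dp e0; exists d => // z zw.
have := hd _ zw; rewrite addrCA subrr addr0.
suff -> : 'd p w (z - w) = 'D_1 p w * (z - w) by [].
by rewrite deriveE // -{1}[z - w]mulr1 linearZ /= mulrC.
Qed.

End NormBasics.

(** * Goursat's lemma for midpoint sums *)

Section Goursat.
Variable R : realType.
Implicit Types (p : R[i]^o -> R[i]^o) (a d s z : R[i]).

(** The midpoint rule with [n] equal steps for the integral of [p] along the segment from [a] to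
    [a + d]. *)
Definition midpoint_sum n p a d : R[i] :=
  \sum_(k < n) p (a + ((k.*2.+1)%:R / (n.*2)%:R)%:C * d) * (d / n%:R).

(* The contour sum over the boundary of the square with corner [a] and sides [s],
   ['i * s]; opposite sides run in the same direction, whence the signs. *)
Definition square_sum n p a s : R[i] :=
  midpoint_sum n p a s + midpoint_sum n p (a + s) ('i * s)
  - midpoint_sum n p (a + 'i * s) s - midpoint_sum n p a ('i * s).

(** The [2 n] midpoints of the doubled segment are exactly the [n] midpoints of each half, with the
    same step. *)
Lemma midpoint_sum_double n p a d :
  midpoint_sum (n + n) p a (d + d)
  = midpoint_sum n p a d + midpoint_sum n p (a + d) d.
Proof.
case: n => [|n]; first by rewrite /midpoint_sum !big_ord0 addr0.
rewrite /midpoint_sum big_split_ord /=.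
have n0 : n.+1%:R != 0 :> R by rewrite pnatr_eq0.
have m0 : n.+1%:R != 0 :> R[i] by rewrite pnatr_eq0.
have h2 : 2 != 0 :> R by rewrite pnatr_eq0.
have h2c : 2 != 0 :> R[i] by rewrite pnatr_eq0.
have wE : (d + d) / (n.+1 + n.+1)%:R = d / n.+1%:R.
  rewrite natrD; move: (n.+1%:R : R[i]) m0 => N N0.
  by field; rewrite N0 /= -mulr2n mulrn_eq0.
congr (_ + _); apply: eq_bigr => k _; rewrite wE; congr (p _ * _).
  congr (_ + _); rewrite mulrDr -mulrDl -rmorphD /=; congr (_%:C * _).
  rewrite -!mul2n !natrM !natrD; move: (n.+1%:R) n0 ((2 * k).+1%:R) => N N0 K.
  by field; rewrite N0 /= -mulr2n mulrn_eq0.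
rewrite -addrA; congr (_ + _).
have -> : ((n.+1 + k).*2.+1%:R / (n.+1 + n.+1).*2%:R)%:C * (d + d)
          = (1 + k.*2.+1%:R / n.+1.*2%:R)%:C * d.
  rewrite mulrDr -mulrDl -rmorphD /=; congr (_%:C * _).
  rewrite doubleD -addnS -!mul2n natrD !natrM natrD.
  move: (n.+1%:R) n0 ((2 * k).+1%:R) => N N0 K.
  by field; rewrite N0 /= -mulr2n mulrn_eq0.
by rewrite rmorphD rmorph1 mulrDl mul1r.
Qed.

(** Each inner edge is shared by two quarters, which count it with opposite signs; the outer edges
    combine by [midpoint_sum_double]. *)
Lemma square_sum_quarter n p a s :
  square_sum (n + n) p a (s + s)
  = square_sum n p a s + square_sum n p (a + s) s
    + square_sum n p (a + 'i * s) s + square_sum n p (a + s + 'i * s) s.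
Proof.
rewrite /square_sum mulrDr !midpoint_sum_double.
rewrite (addrA a s s) (addrA a ('i * s)) (addrAC a ('i * s) s).
rewrite (addrAC (a + s) ('i * s) s) (addrAC (a + 'i * s) ('i * s) s).
rewrite (addrAC a ('i * s) s).
ring.
Qed.

Lemma midpoint_sum_bound n p a d (B : R) : 0 <= B ->
  (forall t : R, 0 <= t <= 1 -> cabs (p (a + t%:C * d)) <= B) ->
  cabs (midpoint_sum n p a d) <= B * cabs d.
Proof.
case: n => [|n] B0 hB.
  by rewrite /midpoint_sum big_ord0 cabs0 mulr_ge0 ?cabs_ge0.
apply: (le_trans (cabs_sum _ _ _)).
have -> : B * cabs d = \sum_(k < n.+1) B * cabs (d / n.+1%:R).
  rewrite sumr_const card_ord cabsM cabsV cabs_nat -[RHS]mulr_natr.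
  by rewrite -mulrA divfK ?pnatr_eq0.
apply: ler_sum => k _; rewrite [leLHS]cabsM; apply: ler_wpM2r; first exact: cabs_ge0.
apply: hB; rewrite divr_ge0 ?ler0n //= ler_pdivrMr ?ltr0n ?double_gt0 //.
by rewrite mul1r ler_nat ltn_double.
Qed.

Lemma square_sum_bound n p a s (al be : R[i]) (B : R) : 0 <= B ->
  (forall x y : R, 0 <= x <= 1 -> 0 <= y <= 1 ->
     forall z, z = a + (x%:C + 'i * y%:C) * s -> cabs (p z - (al + be * z)) <= B) ->
  cabs (square_sum n p a s) <= 4 * B * cabs s.
Proof.
move=> B0 hB; pose q z := p z - (al + be * z).
(* The affine part cancels for each [k]: the horizontal pair of sides contributes
   [- be * 'i * s ^+ 2 / n], the vertical pair its opposite. *)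
have -> : square_sum n p a s = square_sum n q a s.
  apply/eqP; rewrite -subr_eq0; apply/eqP.
  rewrite /square_sum /midpoint_sum -!big_split /= -!sumrB big1 // => k _; rewrite /q.
 ring.
have i1 : 0 <= (1 : R) <= 1 by rewrite ler01 lexx.
have i0 : 0 <= (0 : R) <= 1 by rewrite ler01 lexx.
have h1 : cabs (midpoint_sum n q a s) <= B * cabs s.
  apply: midpoint_sum_bound => // t ht.
  by have := hB t 0 ht i0 _ erefl; rewrite rmorph0 mulr0 addr0.
have h2 : cabs (midpoint_sum n q (a + s) ('i * s)) <= B * cabs s.
  rewrite -[cabs s]mul1r -cabs_i -cabsM; apply: midpoint_sum_bound => // t ht.
  have := hB 1 t i1 ht _ erefl; congr (cabs (q _) <= _).
  by rewrite rmorph1; ring.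
have h3 : cabs (midpoint_sum n q (a + 'i * s) s) <= B * cabs s.
  apply: midpoint_sum_bound => // t ht.
  have := hB t 1 ht i1 _ erefl; congr (cabs (q _) <= _).
  by rewrite rmorph1; ring.
have h4 : cabs (midpoint_sum n q a ('i * s)) <= B * cabs s.
  rewrite -[cabs s]mul1r -cabs_i -cabsM; apply: midpoint_sum_bound => // t ht.
  have := hB 0 t i0 ht _ erefl; congr (cabs (q _) <= _).
  by rewrite rmorph0; ring.
apply: (le_trans (ler_cabsB _ _)).
have := ler_cabsB (midpoint_sum n q a s + midpoint_sum n q (a + s) ('i * s))
                  (midpoint_sum n q (a + 'i * s) s).
have := ler_cabsD (midpoint_sum n q a s) (midpoint_sum n q (a + s) ('i * s)).
by move=> u v; lra.
Qed.

Lemma dyadic_small (d : R) : 0 < d -> exists j, 2 ^- j < d.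
Proof.
move=> d0; exists (Num.bound d^-1).
by rewrite -[ltRHS]invrK ltf_pV2 ?posrE ?exprn_gt0 ?invr_gt0 // upper_nthrootP.
Qed.

(** Nested intervals: every right endpoint bounds all left endpoints, so their supremum is a common
    point. *)
Lemma dyadic_nested (x : nat -> R) :
  (forall j, x j <= x j.+1) ->
  (forall j, x j.+1 + 2 ^- j.+1 <= x j + 2 ^- j) ->
  exists X, forall j, x j <= X <= x j + 2 ^- j.
Proof.
move=> hx hy.
have hx' i j : (i <= j)%N -> x i <= x j.
  by move/subnK => <-; elim: (j - i)%N => // k ih; exact: le_trans ih (hx _).
have hy' i j : (i <= j)%N -> x j + 2 ^- j <= x i + 2 ^- i.
  by move/subnK => <-; elim: (j - i)%N => // k ih; exact: le_trans (hy _) ih.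
have p2 j : 0 < 2 ^- j :> R by rewrite invr_gt0 exprn_gt0.
have ub j : ubound (range x) (x j + 2 ^- j).
  move=> _ [i _ <-]; have [ij|ji] := leqP i j.
    by rewrite (le_trans (hx' _ _ ij)) // lerDl ltW.
  by rewrite (le_trans _ (hy' _ _ (ltnW ji))) // lerDl ltW.
exists (sup (range x)) => j; apply/andP; split.
  apply: ub_le_sup; last by exists j.
  by exists (x 0%N + 2 ^- 0); exact: ub.
by apply: ge_sup; [exists (x j), j|exact: ub].
Qed.

(* If the conclusion failed, then it would fail, at the scale of the square, on a
   nested sequence of dyadic subsquares; at their common point [p] is affine up to
   an error that contradicts this. *)
Lemma square_sum_goursat p a s :
  (forall x y : R, 0 <= x <= 1 -> 0 <= y <= 1 ->
     derivable p (a + (x%:C + 'i * y%:C) * s : R[i]^o) 1) ->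
  forall e, 0 < e -> exists N, forall m, (N <= m)%N ->
    cabs (square_sum (2 ^ m) p a s) <= e.
Proof.
move=> dp.
(* [xy] locates the corner of a subsquare of side [2 ^- j * s], in units of [s]. The bound scales
   with the area, so four good quarters make a good square. *)
pose good (e : R) (j : nat) (xy : R * R) := exists N, forall m, (N <= m)%N ->
  cabs (square_sum (2 ^ m) p (a + (xy.1%:C + 'i * xy.2%:C) * s) ((2 ^- j)%:C * s))
  <= e * (2 ^- j) ^+ 2.
suff H e : 0 < e -> good e 0%N (0, 0).
  move=> e /H[N hN]; exists N => m /hN.
  by rewrite /= rmorph0 mulr0 addr0 mul0r addr0 expr0 invr1 rmorph1 mul1r expr1n mulr1.
move=> e0; apply: contrapT => bad0.
pose half (j : nat) : R := 2 ^- j.+1.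
have halfE j : 2 ^- j = half j + half j.
  by rewrite /half exprS invfM; field; rewrite expf_neq0.
have half_gt0 j : 0 < half j by rewrite invr_gt0 exprn_gt0.
have step j xy : ~ good e j xy -> exists xy', ~ good e j.+1 xy' /\
    (xy.1 <= xy'.1 <= xy.1 + half j) /\ (xy.2 <= xy'.2 <= xy.2 + half j).
  move=> bad; apply: contrapT => hall; apply: bad.
  have gd u v : u \in [:: 0; half j] -> v \in [:: 0; half j] ->
      good e j.+1 (xy.1 + u, xy.2 + v).
    rewrite !inE => hu hv; apply: contrapT => hb; apply: hall.
    exists (xy.1 + u, xy.2 + v); split => //=; have := half_gt0 j.
    by case/orP: hu => /eqP ->; case/orP: hv => /eqP -> ?; lra.
  have [N1 h1] := gd 0 0 (mem_head _ _) (mem_head _ _).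
  have hm : half j \in [:: 0; half j] by rewrite !inE eqxx orbT.
  have [N2 h2] := gd _ 0 hm (mem_head _ _).
  have [N3 h3] := gd 0 _ (mem_head _ _) hm.
  have [N4 h4] := gd _ _ hm hm.
  (* The successor is there because [2 ^ m.+1] nodes on a side leave [2 ^ m] for each half. *)
  exists (maxn (maxn N1 N2) (maxn N3 N4)).+1 => -[//|m]; rewrite ltnS !geq_max.
  case/andP => /andP[/h1 {}h1 /h2 {}h2] /andP[/h3 {}h3 /h4 {}h4].
  rewrite expnS mul2n -addnn halfE.
  set b := a + _; set t := (half j)%:C * s.
  have -> : (half j + half j)%:C * s = t + t by rewrite rmorphD mulrDl.
  rewrite square_sum_quarter.
  have e1 : a + ((xy.1 + 0)%:C + 'i * (xy.2 + 0)%:C) * s = b by rewrite !addr0.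
  have e2 : a + ((xy.1 + half j)%:C + 'i * (xy.2 + 0)%:C) * s = b + t.
    by rewrite /b /t addr0 rmorphD /=; ring.
  have e3 : a + ((xy.1 + 0)%:C + 'i * (xy.2 + half j)%:C) * s = b + 'i * t.
    by rewrite /b /t addr0 rmorphD /=; ring.
  have e4 : a + ((xy.1 + half j)%:C + 'i * (xy.2 + half j)%:C) * s = b + t + 'i * t.
    by rewrite /b /t !rmorphD /=; ring.
  rewrite /= -/(half j) -/t in h1 h2 h3 h4.
  rewrite e1 in h1; rewrite e2 in h2; rewrite e3 in h3; rewrite e4 in h4.
  have -> : e * (half j + half j) ^+ 2 = e * half j ^+ 2 + e * half j ^+ 2
    + e * half j ^+ 2 + e * half j ^+ 2 by ring.
  apply: (le_trans (ler_cabsD _ _)); apply: lerD h4.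
  apply: (le_trans (ler_cabsD _ _)); apply: lerD h3.
  by apply: (le_trans (ler_cabsD _ _)); apply: lerD h2.
(* [nx] selects a bad quarter of a bad square; its value [(0, 0)] on good squares is a dummy. *)
have /choice[nx hnx] : forall u : nat * (R * R), exists xy' : R * R,
    ~ good e u.1 u.2 -> ~ good e u.1.+1 xy' /\
    (u.2.1 <= xy'.1 <= u.2.1 + half u.1) /\ (u.2.2 <= xy'.2 <= u.2.2 + half u.1).
  move=> u; have [gu|bu] := pselect (good e u.1 u.2); first by exists (0, 0).
  by have [xy' h] := step _ _ bu; exists xy'.
pose q := fix q j := if j is j'.+1 then nx (j', q j') else ((0, 0) : R * R).
have badq j : ~ good e j (q j).
  by elim: j => // j ih; have [] := hnx (j, q j) ih.
have hq j := (hnx (j, q j) (badq j)).2.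
have [X hX] : exists X, forall j, (q j).1 <= X <= (q j).1 + 2 ^- j.
  apply: dyadic_nested => j; have [/= h _] := hq j; first by case/andP: h.
  by rewrite [in leRHS]halfE addrA lerD2r; case/andP: h.
have [Y hY] : exists Y, forall j, (q j).2 <= Y <= (q j).2 + 2 ^- j.
  apply: dyadic_nested => j; have [_ /= h] := hq j; first by case/andP: h.
  by rewrite [in leRHS]halfE addrA lerD2r; case/andP: h.
have [c hc] : exists c, forall e, 0 < e -> exists2 d : R, 0 < d & forall z,
    cabs (z - (a + (X%:C + 'i * Y%:C) * s)) < d ->
    cabs (p z - p (a + (X%:C + 'i * Y%:C) * s)
          - c * (z - (a + (X%:C + 'i * Y%:C) * s)))
      <= e * cabs (z - (a + (X%:C + 'i * Y%:C) * s)).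
  eexists; apply: derivable_expansion; apply: dp.
    by have := hX 0%N; rewrite /= expr0 invr1 add0r.
  by have := hY 0%N; rewrite /= expr0 invr1 add0r.
set w := a + _ in hc.
(* The summand 1 keeps [S] positive if [s = 0]. On a subsquare of scale [r], points are within
   [2 r S] of [w], so the affine error is at most [eta * 2 r S] and [square_sum_bound] gives
   [8 eta S^2 r^2 = e r^2]. *)
pose S := 1 + cabs s; have S_gt0 : 0 < S by rewrite ltr_pwDl ?cabs_ge0.
have [d d0 hd] := hc (e / (8 * S ^+ 2)) (divr_gt0 e0 (mulr_gt0 (ltr0n _ 8) (exprn_gt0 2 S_gt0))).
have [j hj] : exists j, 2 * 2 ^- j * S < d.
  have [j hj] := dyadic_small (divr_gt0 d0 (mulr_gt0 (ltr0n _ 2) S_gt0)).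
  by exists j; rewrite -mulrA mulrCA -ltr_pdivlMr ?mulr_gt0.
apply: (badq j); exists 0%N => m _.
set eta := e / (8 * S ^+ 2) in hd; have [hXj hYj] := (hX j, hY j).
have : 0 < 2 ^- j :> R by rewrite invr_gt0 exprn_gt0.
move: (2 ^- j) hj hXj hYj => r hj hXj hYj r0.
have S8 : 0 < 8 * S ^+ 2 by rewrite mulr_gt0 ?ltr0n ?exprn_gt0.
have eta0 : 0 < eta by apply: divr_gt0.
have etaE : eta * (8 * S ^+ 2) = e by rewrite /eta divfK // gt_eqF.
move: eta eta0 etaE hd => eta eta0 etaE hd.
have B0 : 0 <= eta * (2 * r * S) by rewrite mulr_ge0 ?mulr_ge0 ?ler0n ?ltW.
have sS : cabs s <= S by rewrite lerDr.
apply: le_trans (@square_sum_bound (2 ^ m) p _ (r%:C * s) (p w - c * w) c _ B0 _) _.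
  move=> x y hx hy z zE.
  have zw : z - w = (((q j).1 + r * x - X)%:C + 'i * ((q j).2 + r * y - Y)%:C) * s.
    by rewrite zE /w !(rmorphB, rmorphD, rmorphM) /=; ring.
  have czw : cabs (z - w) <= 2 * r * S.
    rewrite zw cabsM; apply: ler_pM; rewrite ?cabs_ge0 //.
    rewrite (le_trans (ler_cabsD _ _)) // cabsM cabs_i mul1r !cabs_real.
    have rx : 0 <= r * x <= r by nra.
    have ry : 0 <= r * y <= r by nra.
    have hx1 : `|(q j).1 + r * x - X| <= r by rewrite ler_norml; lra.
    have hy1 : `|(q j).2 + r * y - Y| <= r by rewrite ler_norml; lra.
    by lra.
  have := hd z (le_lt_trans czw hj).
  have -> : p z - p w - c * (z - w) = p z - (p w - c * w + c * z) by ring.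
  by move/le_trans; apply; rewrite ler_pM2l.
rewrite cabsM cabs_real gtr0_norm // -etaE.
have -> : eta * (8 * S ^+ 2) * r ^+ 2 = 4 * (eta * (2 * r * S)) * (r * S) by ring.
by apply: ler_wpM2l; [rewrite mulr_ge0 ?ler0n|rewrite ler_wpM2l // ltW].
Qed.

End Goursat.

(** * Cauchy's estimate *)

Lemma derivable_div_sqr (K : numFieldType) (g : K -> K) (w : K) : w != 0 ->
  derivable g w 1 -> derivable (fun z => g z / z ^+ 2) w 1.
Proof.
move=> w0 dg; apply: (derivableM dg); apply: derivableV; first exact: expf_neq0.
exact: exprn_derivable.
Qed.

Section CauchyEstimate.
Variable R : realType.
Implicit Types (p g : R[i]^o -> R[i]^o) (a s z c : R[i]).

Definition vanishing (u : nat -> R[i]) :=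
  forall e : R, 0 < e -> exists N, forall m, (N <= m)%N -> cabs (u m) <= e.

Lemma vanishingD (u v : nat -> R[i]) :
  vanishing u -> vanishing v -> vanishing (fun m => u m + v m).
Proof.
move=> hu hv e e0; have e2 : 0 < e / 2 by rewrite divr_gt0.
have [N1 h1] := hu _ e2; have [N2 h2] := hv _ e2.
exists (maxn N1 N2) => m; rewrite geq_max => /andP[/h1 {}h1 /h2 {}h2].
by have := ler_cabsD (u m) (v m); lra.
Qed.

Lemma vanishing_shift (u : nat -> R[i]) k :
  vanishing u -> vanishing (fun m => u (m + k)%N).
Proof.
by move=> hu e /hu[N hN]; exists N => m Nm; rewrite hN // (leq_trans Nm) ?leq_addr.
Qed.

(** [square_sum_quarter] with the corners up to provable equality, so that each can be given in grid
    coordinates. *)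
Lemma cell_decomposition n p a b c d s : b = a + s -> c = a + 'i * s ->
  d = a + s + 'i * s ->
  square_sum (n + n) p a (s + s)
  = square_sum n p a s + square_sum n p b s
    + square_sum n p c s + square_sum n p d s.
Proof. by move=> -> -> ->; exact: square_sum_quarter. Qed.

(* The square with vertices [+- s +- 'i s]. *)
Definition centered_square_sum n p (s : R) : R[i] :=
  square_sum n p ((- s)%:C * (1 + 'i)) (s%:C + s%:C).

(* The cells are the twelve outer ones of a 4 x 4 grid; none of them contains 0. *)
Lemma centered_square_sum_annulus n p (s : R) :
  let F x y := square_sum n p ((x%:C + 'i * y%:C) * s%:C) s%:C in
  centered_square_sum (n + n + (n + n)) p (s + s)
  - centered_square_sum (n + n) p s
  = F (-2) (-2) + F (-1) (-2) + F 0 (-2) + F 1 (-2)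
    + F (-2) (-1) + F 1 (-1) + F (-2) 0 + F 1 0
    + F (-2) 1 + F (-1) 1 + F 0 1 + F 1 1.
Proof.
move=> F; rewrite /centered_square_sum.
(* [G x y] is a 2 x 2 block of cells. Four corner blocks tile the large square, and the central
   block [G (-1) (-1)] is the small one. *)
pose G x y := square_sum (n + n) p ((x%:C + 'i * y%:C) * s%:C) (s%:C + s%:C).
have GE x y : G x y = F x y + F (x + 1) y + F x (y + 1) + F (x + 1) (y + 1).
  by apply: cell_decomposition; rewrite !rmorphD ?rmorph1 /=; ring.
have -> : square_sum (n + n) p ((- s)%:C * (1 + 'i)) (s%:C + s%:C) = G (-1) (-1).
  by rewrite /G; congr square_sum; rewrite !rmorphN rmorph1 /=; ring.
have -> : square_sum (n + n + (n + n)) p ((- (s + s))%:C * (1 + 'i))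
             ((s + s)%:C + (s + s)%:C)
          = G (-2) (-2) + G 0 (-2) + G (-2) 0 + G 0 0.
  rewrite rmorphD /=; rewrite (@cell_decomposition _ _ _
     ((0%:C + 'i * (-2)%:C) * s%:C) (((-2)%:C + 'i * 0%:C) * s%:C)
     ((0%:C + 'i * 0%:C) * s%:C)).
  - rewrite /G; congr (square_sum _ _ _ _ + _ + _ + _).
    by rewrite !(rmorph_nat (real_complex R), rmorphN, rmorphD, rmorph0) /=; ring.
  - by rewrite !(rmorph_nat (real_complex R), rmorphN, rmorphD, rmorph0) /=; ring.
  - by rewrite !(rmorph_nat (real_complex R), rmorphN, rmorphD, rmorph0) /=; ring.
  - by rewrite !(rmorph_nat (real_complex R), rmorphN, rmorphD, rmorph0) /=; ring.
rewrite !GE.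
have -> : -2 + 1 = -1 :> R by ring.
have -> : -1 + 1 = 0 :> R by ring.
rewrite !add0r; ring.
Qed.

(** The integrand is derivable on each of the twelve cells of the annulus, so Goursat's lemma
    applies to each. With [2 ^ m] nodes per cell side, the large square has [2 ^ m.+2] and the small
    one [2 ^ m.+1]. *)
Lemma centered_square_sum_half g (s : R) : 0 < s ->
  (forall z : R[i]^o, cabs z <= 2 * (s + s) -> derivable g z 1) ->
  vanishing (fun m =>
    centered_square_sum (2 ^ m.+2) (fun z => g z / z ^+ 2) (s + s)
    - centered_square_sum (2 ^ m.+1) (fun z => g z / z ^+ 2) s).
Proof.
move=> s0 dg.
(* The disjunction keeps the cell with corner [(x, y)] and side 1 away from the origin. *)
have cell (x y : R) : -2 <= x <= 1 -> -2 <= y <= 1 ->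
    [|| x <= -2, 1 <= x, y <= -2 | 1 <= y] ->
    vanishing (fun m => square_sum (2 ^ m) (fun z => g z / z ^+ 2)
      ((x%:C + 'i * y%:C) * s%:C) s%:C).
  move=> hx hy out; apply: square_sum_goursat => t u ht hu.
  have -> : (x%:C + 'i * y%:C) * s%:C + (t%:C + 'i * u%:C) * s%:C
     = (s * (x + t))%:C + 'i * (s * (y + u))%:C.
    by rewrite !rmorphM !rmorphD /=; ring.
  have hxt : `|s * (x + t)| <= s * 2 by rewrite ler_norml; nra.
  have hyu : `|s * (y + u)| <= s * 2 by rewrite ler_norml; nra.
  apply: (@derivable_div_sqr R[i] g).
    rewrite eq_complex /= !(mul0r, mul1r, mulr0, addr0, add0r, subr0).
    rewrite negb_and !mulf_eq0 !(gt_eqF s0) /=.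
    by case/or4P: out => h; apply/orP; [left|left|right|right]; apply/eqP; lra.
  apply: dg; apply: le_trans (ler_cabsD _ _) _.
  by rewrite cabsM cabs_i mul1r !cabs_real; lra.
have -> : (fun m => centered_square_sum (2 ^ m.+2) (fun z => g z / z ^+ 2) (s + s)
    - centered_square_sum (2 ^ m.+1) (fun z => g z / z ^+ 2) s) = (fun m =>
    centered_square_sum (2 ^ m + 2 ^ m + (2 ^ m + 2 ^ m)) (fun z => g z / z ^+ 2) (s + s)
    - centered_square_sum (2 ^ m + 2 ^ m) (fun z => g z / z ^+ 2) s).
  by apply/funext => m; rewrite !addnn -!mul2n -!expnS.
under eq_fun do rewrite centered_square_sum_annulus.
do 11! [apply: vanishingD; last by apply: cell; rewrite ?lexx ?orbT //; lra].
by apply: cell; rewrite ?lexx ?orbT //; lra.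
Qed.

(** Telescoping over [j] halvings. Halving the square also halves the number of nodes per side,
    hence the shift of the exponent by [j]. *)
Lemma centered_square_sum_dyadic g (s : R) j : 0 < s ->
  (forall z : R[i]^o, cabs z <= 2 * s -> derivable g z 1) ->
  vanishing (fun m =>
    centered_square_sum (2 ^ (m + j).+1) (fun z => g z / z ^+ 2) s
    - centered_square_sum (2 ^ m.+1) (fun z => g z / z ^+ 2) (2 ^- j * s)).
Proof.
move=> s0 dg; elim: j => [|j ih].
  move=> e e0; exists 0%N => m _.
  by rewrite addn0 expr0 invr1 mul1r subrr cabs0 ltW.
have r0 : 0 < 2 ^- j.+1 * s by rewrite mulr_gt0 ?invr_gt0 ?exprn_gt0.
have rE : 2 ^- j.+1 * s + 2 ^- j.+1 * s = 2 ^- j * s.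
  by rewrite exprS invfM; field; rewrite expf_neq0.
have := @centered_square_sum_half g _ r0; rewrite rE => step.
have rs : 2 ^- j * s <= s.
  by rewrite ger_pMl // invf_le1 ?exprn_gt0 // exprn_ege1 // ler1n.
have {}step := step (fun z hz => dg z (le_trans hz (ler_wpM2l (ler0n _ 2) rs))).
have := vanishingD (vanishing_shift 1 ih) step.
congr vanishing; apply/funext => m.
by rewrite addn1 addrA subrK addSn addnS.
Qed.

(** The boundary lies in the annulus [s <= |z| <= 2 s] and has length [8 s]. *)
Lemma centered_square_sum_bound n p (s B : R) : 0 < s -> 0 <= B ->
  (forall z, s <= cabs z -> cabs z <= 2 * s -> cabs (p z) <= B) ->
  cabs (centered_square_sum n p s) <= 8 * B * s.
Proof.
move=> s0 B0 hp.
have side (x y : R) : `|x| <= s -> `|y| <= s -> (`|x| == s) || (`|y| == s) ->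
    cabs (p (x%:C + 'i * y%:C)) <= B.
  move=> hx hy hs; apply: hp.
    have := cabs_ge_Re (x%:C + 'i * y%:C); have := cabs_ge_Im (x%:C + 'i * y%:C).
    rewrite /= !(mul0r, mul1r, mulr0, addr0, add0r, subr0).
    by case/orP: hs => /eqP ->.
  apply: le_trans (ler_cabsD _ _) _.
  by rewrite cabsM cabs_i mul1r !cabs_real; lra.
have ss : cabs (s%:C + s%:C) = 2 * s.
  by rewrite -rmorphD cabs_real gtr0_norm ?addr_gt0 // mulr2n mulrDl mul1r.
have iss : cabs ('i * (s%:C + s%:C)) = 2 * s by rewrite cabsM cabs_i mul1r.
have hh (t : R) : 0 <= t <= 1 -> `|s * (2 * t - 1)| <= s.
  by move=> ht; rewrite ler_norml; nra.
have nn : `|s| = s by rewrite gtr0_norm.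
have nN : `|- s| = s by rewrite normrN.
have h1 : cabs (midpoint_sum n p ((- s)%:C * (1 + 'i)) (s%:C + s%:C)) <= B * (2 * s).
  rewrite -ss; apply: midpoint_sum_bound => // t ht.
  have := side (s * (2 * t - 1)) (- s) (hh t ht); rewrite nN lexx eqxx orbT.
  move=> /(_ isT isT); congr (cabs (p _) <= _).
  by rewrite !((rmorph_nat (real_complex R)), rmorphM, rmorphB, rmorphN, rmorph1) /=; ring.
have h2 : cabs (midpoint_sum n p ((- s)%:C * (1 + 'i) + (s%:C + s%:C))
    ('i * (s%:C + s%:C))) <= B * (2 * s).
  rewrite -iss; apply: midpoint_sum_bound => // t ht.
  have := side s (s * (2 * t - 1)); rewrite nn lexx eqxx.
  move=> /(_ isT (hh t ht) isT); congr (cabs (p _) <= _).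
  by rewrite !((rmorph_nat (real_complex R)), rmorphM, rmorphB, rmorphN, rmorph1) /=; ring.
have h3 : cabs (midpoint_sum n p ((- s)%:C * (1 + 'i) + 'i * (s%:C + s%:C))
    (s%:C + s%:C)) <= B * (2 * s).
  rewrite -ss; apply: midpoint_sum_bound => // t ht.
  have := side (s * (2 * t - 1)) s (hh t ht); rewrite nn lexx eqxx orbT.
  move=> /(_ isT isT); congr (cabs (p _) <= _).
  by rewrite !((rmorph_nat (real_complex R)), rmorphM, rmorphB, rmorphN, rmorph1) /=; ring.
have h4 : cabs (midpoint_sum n p ((- s)%:C * (1 + 'i))
    ('i * (s%:C + s%:C))) <= B * (2 * s).
  rewrite -iss; apply: midpoint_sum_bound => // t ht.
  have := side (- s) (s * (2 * t - 1)); rewrite nN lexx eqxx.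
  move=> /(_ isT (hh t ht) isT); congr (cabs (p _) <= _).
  by rewrite !((rmorph_nat (real_complex R)), rmorphM, rmorphB, rmorphN, rmorph1) /=; ring.
rewrite /centered_square_sum /square_sum.
apply: (le_trans (ler_cabsB _ _)).
have -> : 8 * B * s = B * (2 * s) + B * (2 * s) + B * (2 * s) + B * (2 * s) by ring.
apply: lerD h4; apply: (le_trans (ler_cabsB _ _)); apply: lerD h3.
by apply: (le_trans (ler_cabsD _ _)); apply: lerD h2.
Qed.

Lemma centered_square_sumB n p g (s : R) :
  centered_square_sum n (fun z => p z - g z) s
  = centered_square_sum n p s - centered_square_sum n g s.
Proof.
apply/eqP; rewrite -subr_eq0; apply/eqP.
rewrite /centered_square_sum /square_sum /midpoint_sum.
rewrite -!big_split /= -!sumrB big1 // => k _; ring.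
Qed.

(* [S] is a midpoint sum for the integral of 4 / (1 + t^2) over [-1, 1]. *)
Lemma centered_square_sum_inv n c (s : R) : 0 < s ->
  exists2 S : R, 4 <= S & centered_square_sum n.+1 (fun z => c / z) s = c * 'i * S%:C.
Proof.
move=> s0; pose t (k : nat) : R := k.*2.+1%:R / n.+1.*2%:R.
(* The nodes transported from [0, 1] to [-1, 1]. *)
pose tau k := 2 * t k - 1.
exists (\sum_(k < n.+1) 8 / n.+1%:R / (1 + tau k ^+ 2)).
  have -> : 4 = \sum_(k < n.+1) 4 / n.+1%:R :> R.
    by rewrite sumr_const card_ord -[RHS]mulr_natr divfK ?pnatr_eq0.
  apply: ler_sum => k _; have n0 : 0 < n.+1%:R :> R by rewrite ltr0n.
  have tk : 0 <= t k <= 1.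
    rewrite /t divr_ge0 ?ler0n //= ler_pdivrMr ?ltr0n ?double_gt0 //.
    by rewrite mul1r ler_nat ltn_double.
  have tauk : 0 < 1 + tau k ^+ 2 <= 2 by rewrite /tau; nra.
  rewrite ler_pdivlMr; last by case/andP: tauk.
  have -> : 8 / n.+1%:R = 4 / n.+1%:R * 2 :> R by rewrite mulrAC; congr (_ / _); ring.
  by rewrite ler_wpM2l ?divr_ge0 ?ler0n //; case/andP: tauk.
rewrite rmorph_sum mulr_sumr /centered_square_sum /square_sum /midpoint_sum.
rewrite -!big_split /= -!sumrB; apply: eq_bigr => k _.
rewrite -/(t k); set N : R[i] := n.+1%:R.
have s0c : s%:C != 0 by rewrite -(rmorph0 (real_complex R)) (inj_eq (@complexI R)) gt_eqF.
have i2 : 'i * 'i = -1 :> R[i] by rewrite -expr2 sqr_i.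
pose T := (tau k)%:C; have tE : (t k)%:C = (T + 1) / 2.
  rewrite /T /tau !(rmorph_nat (real_complex R), rmorphB, rmorphM, rmorph1) /=.
  by rewrite subrK mulrAC mulfV ?mul1r ?pnatr_eq0.
have D0 : 1 + T ^+ 2 != 0.
  rewrite -rmorphXn -(rmorph1 (real_complex R)) -rmorphD.
  rewrite -(rmorph0 (real_complex R)) (inj_eq (@complexI R)) gt_eqF //.
  by rewrite ltr_pwDl ?ltr01 ?sqr_ge0.
have h2 : 2 != 0 :> R[i] by rewrite pnatr_eq0.
(* To be used with [u] a node on the boundary and [v] its conjugate divided by [s]. *)
have inv u v : u * v = s%:C * (1 + T ^+ 2) -> u^-1 = v / (s%:C * (1 + T ^+ 2)).
  move=> uv; have uv0 : u * v != 0 by rewrite uv mulf_neq0.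
  have v0 : v != 0 by apply: contraNneq uv0 => ->; rewrite mulr0.
  by rewrite -uv invfM mulrCA mulfV ?mulr1.
have e1 : ((- s)%:C * (1 + 'i) + (t k)%:C * (s%:C + s%:C))^-1
          = (T + 'i) / (s%:C * (1 + T ^+ 2)).
  apply: inv; rewrite tE rmorphN /=.
  transitivity (s%:C * (T ^+ 2 - 'i * 'i)); first by field.
  by rewrite i2 opprK addrC.
have e2 : ((- s)%:C * (1 + 'i) + (s%:C + s%:C) + (t k)%:C * ('i * (s%:C + s%:C)))^-1
          = (1 - 'i * T) / (s%:C * (1 + T ^+ 2)).
  apply: inv; rewrite tE rmorphN /=.
  transitivity (s%:C * (1 - ('i * 'i) * T ^+ 2)); first by field.
  by rewrite i2 mulN1r opprK.
have e3 : ((- s)%:C * (1 + 'i) + 'i * (s%:C + s%:C) + (t k)%:C * (s%:C + s%:C))^-1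
          = (T - 'i) / (s%:C * (1 + T ^+ 2)).
  apply: inv; rewrite tE rmorphN /=.
  transitivity (s%:C * (T ^+ 2 - 'i * 'i)); first by field.
  by rewrite i2 opprK addrC.
have e4 : ((- s)%:C * (1 + 'i) + (t k)%:C * ('i * (s%:C + s%:C)))^-1
          = (- 1 - 'i * T) / (s%:C * (1 + T ^+ 2)).
  apply: inv; rewrite tE rmorphN /=.
  transitivity (s%:C * (1 - ('i * 'i) * T ^+ 2)); first by field.
  by rewrite i2 mulN1r opprK.
rewrite e1 e2 e3 e4 {e1 e2 e3 e4}.
have -> : (8 / n.+1%:R / (1 + tau k ^+ 2))%:C = 8 / N / (1 + T ^+ 2).
  rewrite !(rmorphM, fmorphV, rmorph_nat (real_complex R)) /=.
  by rewrite rmorphD rmorph1 rmorphXn.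
have N0 : N != 0 by rewrite pnatr_eq0.
move: N N0 D0 => N N0 D0.
by field; rewrite N0 s0c D0.
Qed.

(* Near 0, [g z / z ^+ 2] is close to [g'(0) / z], whose contour sum has modulus at
   least 4 |g'(0)|; Goursat moves the contour out to the square of half-side [rho]. *)
Lemma cauchy_estimate0 g (rho B : R) : 0 < rho ->
  (forall z : R[i]^o, cabs z <= 2 * rho -> derivable g z 1) ->
  (forall z : R[i]^o, cabs z <= 2 * rho -> cabs (g z) <= B) ->
  g 0 = 0 -> cabs ('D_1 g 0) <= 2 * B / rho.
Proof.
move=> r0 dg gB g0.
have B0 : 0 <= B by rewrite (le_trans (cabs_ge0 (g 0))) // gB // cabs0 mulr_ge0 ?ltW.
apply/ler_addgt0Pr => e e0.
(* The errors are [e / 10] from moving the contour and [8 e / 10] from linearising [g]; together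
   they stay below the [4 e] available at the end. *)
have e10 : 0 < e / 10 by rewrite divr_gt0.
set c := 'D_1 g 0.
have h0 : cabs (0 : R[i]^o) <= 2 * rho by rewrite cabs0 mulr_ge0 ?ltW.
have [d d0 hd] := derivable_expansion (dg _ h0) e10.
rewrite -/c g0 in hd.
(* The square of half-side [2 ^- j * rho] then lies in the disc where the expansion of [g] at 0 is
   valid. *)
have [j hj] : exists j, 2 * 2 ^- j * rho < d.
  have [j hj] := dyadic_small (divr_gt0 d0 (mulr_gt0 (ltr0n _ 2) r0)).
  by exists j; rewrite -mulrA mulrCA -ltr_pdivlMr ?mulr_gt0.
have [N /(_ N (leqnn N)) hN] := centered_square_sum_dyadic j r0 dg e10.
set p := fun z => g z / z ^+ 2 in hN; set s := 2 ^- j * rho in hN.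
have s0 : 0 < s by rewrite mulr_gt0 ?invr_gt0 ?exprn_gt0.
have up : cabs (centered_square_sum (2 ^ (N + j).+1) p rho) <= 8 * (B / rho ^+ 2) * rho.
  apply: centered_square_sum_bound => //; first by rewrite divr_ge0 // exprn_ge0 // ltW.
  move=> z zr1 zr2; rewrite cabsM cabsV cabsX; apply: ler_pM;
    rewrite ?invr_ge0 ?exprn_ge0 ?cabs_ge0 ?gB //.
  rewrite lef_pV2 ?posrE ?exprn_gt0 ?(lt_le_trans r0) //.
  by rewrite ler_pXn2r ?nnegrE ?cabs_ge0 // ltW.
have lin : cabs (centered_square_sum (2 ^ N.+1) (fun z => p z - c / z) s)
    <= 8 * (e / 10 / s) * s.
  apply: centered_square_sum_bound => //; first by rewrite divr_ge0 ?ltW.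
  move=> z zs1 zs2; have z0 : 0 < cabs z by rewrite (lt_le_trans s0).
  have z0' : z != 0 by rewrite -cabs_gt0.
  have -> : p z - c / z = (g z - c * z) / z ^+ 2 by rewrite /p; field.
  rewrite cabsM cabsV cabsX ler_pdivrMr ?exprn_gt0 //.
  have := hd z; rewrite !subr0 => {}hd.
  apply: le_trans (hd _) _; first by rewrite (le_lt_trans zs2) // mulrA.
  rewrite -[e / 10 / s * _]mulrA ler_wpM2l ?(ltW e10) //.
  by rewrite expr2 mulrA ler_pMl // mulrC ler_pdivlMr // mul1r.
rewrite centered_square_sumB in lin.
have [M M2] : exists M, (2 ^ N.+1 = M.+1)%N.
  by exists (2 ^ N.+1).-1; rewrite prednK ?expn_gt0.
have [S S4 SE] := @centered_square_sum_inv M c s s0.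
have cS : 4 * cabs c <= cabs (centered_square_sum (2 ^ N.+1) (fun z => c / z) s).
  rewrite M2 SE !cabsM cabs_i mulr1 cabs_real mulrC ler_wpM2l ?cabs_ge0 //.
  by rewrite (le_trans S4) // ler_norm.
have -> : 2 * B / rho + e = (8 * (B / rho ^+ 2) * rho + 4 * e) / 4.
  by field; rewrite gt_eqF.
rewrite ler_pdivlMr // mulrC.
have e8 : 8 * (e / 10 / s) * s = 8 * (e / 10) by field; rewrite gt_eqF.
rewrite e8 in lin.
set U := centered_square_sum _ p rho in hN up; set V := centered_square_sum _ p s in hN lin.
set W := centered_square_sum _ (fun z => c / z) s in cS lin.
have : W = U - (U - V) - (V - W) by ring.
move=> WE; have := ler_cabsB (U - (U - V)) (V - W); rewrite -WE.
have := ler_cabsB U (U - V); lra.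
Qed.

(** Subtracting [g 0] reduces to [cauchy_estimate0] and at most doubles the bound on the
    function. *)
Lemma cauchy_estimate g (rho B : R) : 0 < rho ->
  (forall z : R[i]^o, cabs z <= 2 * rho -> derivable g z 1) ->
  (forall z : R[i]^o, cabs z <= 2 * rho -> cabs (g z) <= B) ->
  cabs ('D_1 g 0) <= 4 * B / rho.
Proof.
move=> r0 dg gB; pose f : R[i]^o -> R[i]^o := fun z => g z - g 0.
have h0 : cabs (0 : R[i]^o) <= 2 * rho by rewrite cabs0 mulr_ge0 ?ltW.
have is_d (z : R[i]^o) : cabs z <= 2 * rho -> is_derive z 1 f ('D_1 g z).
  move=> hz; rewrite -[X in is_derive _ _ _ X]subr0.
  by apply: is_deriveB; apply: derivableP; exact: dg.
have -> : 'D_1 g 0 = 'D_1 f 0 by apply/esym; apply: (@derive_val); exact: is_d.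
have -> : 4 * B = 2 * (2 * B) by ring.
apply: (@cauchy_estimate0 f rho (2 * B) r0) => [z hz|z hz|].
- by have [] := is_d z hz.
- apply: (le_trans (ler_cabsB _ _)).
  by have := gB _ hz; have := gB _ h0; lra.
- by rewrite /f subrr.
Qed.

End CauchyEstimate.

(** * The tangential derivative *)

Section Tangential.
Variable R : realType.

Lemma is_derive_expansion (phi : R -> R) (t l : R) :
  (forall e, 0 < e -> exists2 d : R, 0 < d & forall u, `|u| < d ->
     `|phi (t + u) - phi t - l * u| <= e * `|u|) ->
  is_derive t 1 phi l.
Proof.
move=> h.
have hl : h^-1 *: ((phi \o shift t) (h *: 1) - phi t) @[h --> 0^'] --> l.
  apply/cvgrPdist_le => e e0; have [d d0 hd] := h e e0.
  rewrite near_withinE; apply/nbhs_ballP; exists d => // u.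
  rewrite /ball /= sub0r normrN => ud u0.
  rewrite /= distrC [u%:A]mulr1 (addrC u t) -[_ *: _]/(u^-1 * _).
  have -> : u^-1 * (phi (t + u) - phi t) - l = (phi (t + u) - phi t - l * u) / u.
    by field.
  rewrite normrM normfV ler_pdivrMr ?normr_gt0 //; exact: hd.
apply: DeriveDef; [exact: cvgP hl|exact: cvg_lim hl].
Qed.

(* Apply the real mean value theorem to [Re (D^* h)], where [D] is the increment. *)
Lemma mean_value_bound (X : normedModType R[i]) (h : X -> R[i]^o) (a v : X) (K : R) :
  (forall t : R, 0 <= t <= 1 -> differentiable h (a + t%:C *: v) /\
     cabs ('d h (a + t%:C *: v) v) <= K) ->
  cabs (h (a + v) - h a) <= K.
Proof.
move=> hd; pose D : R[i] := h (a + v) - h a.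
pose phi (t : R) := complex.Re (D^* * h (a + t%:C *: v)).
pose dphi (t : R) := complex.Re (D^* * 'd h (a + t%:C *: v) v).
have K0 : 0 <= K.
  by have [|_] := hd 0; [rewrite lexx ler01|exact/le_trans/cabs_ge0].
have dP (t : R) : 0 <= t <= 1 -> is_derive t 1 phi (dphi t).
  move=> ht; apply: is_derive_expansion => e e0.
  have [dh _] := hd t ht.
  have S0 : 0 < 1 + cabs D * nrm v by rewrite ltr_pwDl // mulr_ge0 ?cabs_ge0 ?nrm_ge0.
  have [d d0 hd'] := diff_expansion dh (divr_gt0 e0 S0).
  have v0 : 0 < 1 + nrm v by rewrite ltr_pwDl ?nrm_ge0.
  exists (d / (1 + nrm v)); first exact: divr_gt0.
  move=> u; rewrite ltr_pdivlMr // => ud.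
  have uv : nrm (u%:C *: v) < d.
    by rewrite nrmZ cabs_real (le_lt_trans _ ud) // ler_wpM2l // lerDr.
  have := hd' _ uv.
  rewrite -(addrA a) -scalerDl -rmorphD /= linearZ /=.
  set w := _ - _ - _; rewrite nrmZ cabs_real => hw.
  have -> : phi (t + u) - phi t - dphi t * u = complex.Re (D^* * w).
    have Re_mulr (z : R[i]) (x : R) : complex.Re z * x = complex.Re (z * x%:C).
      by case: z => z1 z2 /=; rewrite mulr0 subr0.
    rewrite /phi /dphi Re_mulr -!raddfB; congr complex.Re; rewrite /w.
    by rewrite !mulrBr; congr (_ - _); rewrite -mulrA; congr (_ * _); exact: mulrC.
  apply: le_trans (cabs_ge_Re _) _; rewrite cabsM cabs_conj.
  apply: le_trans (ler_wpM2l (cabs_ge0 _) hw) _.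
  have -> : cabs D * (e / (1 + cabs D * nrm v) * (`|u| * nrm v))
    = e * `|u| * ((cabs D * nrm v) / (1 + cabs D * nrm v)) by field; rewrite gt_eqF.
  rewrite ler_piMr ?mulr_ge0 ?(ltW e0) // ler_pdivrMr // mul1r; lra.
have [] := @MVT_segment R phi dphi 0 1 ler01.
- by move=> x; rewrite in_itv /= => /andP[x0 x1]; apply: dP; rewrite !ltW.
- apply: derivable_within_continuous => x; rewrite in_itv /= => hx.
  by have [] := dP x hx.
move=> c; rewrite in_itv /= subr0 mulr1 => hc.
rewrite /phi rmorph1 rmorph0 scale1r scale0r addr0 -raddfB -mulrBr -/D => DE.
have D2 : cabs D ^+ 2 <= cabs D * K.
  have -> : cabs D ^+ 2 = complex.Re (D^* * D).
    by rewrite mulrC -sqr_normc cabsE -rmorphXn.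
  rewrite DE (le_trans (ler_norm _)) // (le_trans (cabs_ge_Re _)) //.
  rewrite cabsM cabs_conj ler_wpM2l ?cabs_ge0 //.
  by have [] := hd c hc.
have [D0|D0] := eqVneq (cabs D) 0; first by rewrite -/D D0.
by rewrite -(@ler_pM2l _ (cabs D)) ?lt0r ?D0 ?cabs_ge0 // -expr2.
Qed.

Lemma is_derive_line (X : normedModType R[i]) (h : X -> R[i]^o) (p v : X)
    (b : R[i]^o) : differentiable h (p + b *: v) ->
  is_derive b 1 (fun b : R[i]^o => h (p + b *: v)) ('d h (p + b *: v) v).
Proof.
move=> dh.
have ha : is_diff b (fun b : R[i]^o => p + b *: v) ( *:%R^~ v).
  rewrite -[X in is_diff _ _ X]add0r.
  exact: is_diffD.
have hh : is_diff (p + b *: v) h ('d h (p + b *: v)) by apply: DiffDef.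
have [hc hcE] := @is_diff_comp _ _ _ _ _ _ _ _ b ha hh.
apply: DeriveDef; first exact: diff_derivable.
by rewrite deriveE // hcE /= scale1r.
Qed.

(* [r] plays the role of the square root of the distance to the sphere. *)
Lemma tangential_bound (X : normedModType R[i]) (h : X -> R[i]^o) (e v : X) (M : R) :
  (forall a b : R[i], nrm (a *: e + b *: v) ^+ 2 = cabs a ^+ 2 + cabs b ^+ 2) ->
  (forall w, nrm w < 1 -> differentiable h w) ->
  (forall w x, nrm w < 1 -> (1 - nrm w ^+ 2) * cabs ('d h w x) <= M * nrm x) ->
  forall r : R, 0 < r <= 1 ->
    cabs ('d h ((1 - r ^+ 2)%:C *: e) v) * r <= 128 * M.
Proof.
move=> pyth dh dhM.
have e1 : nrm e = 1.
  have := pyth 1 0; rewrite scale1r scale0r addr0 cabs1 cabs0 expr1n expr0n addr0.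
  by move/eqP; rewrite sqrp_eq1 ?nrm_ge0 // => /eqP.
have v1 : nrm v = 1.
  have := pyth 0 1; rewrite scale1r scale0r add0r cabs1 cabs0 expr1n expr0n add0r.
  by move/eqP; rewrite sqrp_eq1 ?nrm_ge0 // => /eqP.
have M0 : 0 <= M.
  have := dhM 0 e; rewrite nrm0 ltr01 expr0n subr0 mul1r e1 mulr1 => /(_ isT).
  exact/le_trans/cabs_ge0.
have lt1 (w : X) : nrm w ^+ 2 < 1 -> nrm w < 1 by have := nrm_ge0 w; nra.
have step (r : R) : 0 < r -> 2 * r <= 1 ->
    cabs ('d h ((1 - r ^+ 2)%:C *: e) v - 'd h ((1 - (2 * r) ^+ 2)%:C *: e) v) * r
    <= 64 * M.
  move=> r0 r1.
  (* On the disc of radius [r / 2], [|w|^2 <= (1 - r^2)^2 + r^2 / 4 <= 1 - 3 r^2 / 4], using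
     [r^4 <= r^2]. *)
  have norm_w (tau : R) (b : R[i]) : 0 <= tau <= 1 - r ^+ 2 -> cabs b <= 2 * (r / 4) ->
      3 / 4 * r ^+ 2 <= 1 - nrm (tau%:C *: e + b *: v) ^+ 2.
    move=> htau hb; rewrite pyth cabs_real ger0_norm; last by lra.
    have := cabs_ge0 b; nra.
  have in_ball (tau : R) (b : R[i]) : 0 <= tau <= 1 - r ^+ 2 -> cabs b <= 2 * (r / 4) ->
      nrm (tau%:C *: e + b *: v) < 1.
    by move=> htau hb; apply: lt1; have := norm_w _ _ htau hb; nra.
  have t1 : 0 <= 1 - r ^+ 2 <= 1 - r ^+ 2 by nra.
  have t2 : 0 <= 1 - (2 * r) ^+ 2 <= 1 - r ^+ 2 by nra.
  pose g (b : R[i]^o) : R[i]^o := h ((1 - r ^+ 2)%:C *: e + b *: v)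
                     - h ((1 - (2 * r) ^+ 2)%:C *: e + b *: v).
  have dg (b : R[i]^o) : cabs b <= 2 * (r / 4) -> is_derive b 1 g
      ('d h ((1 - r ^+ 2)%:C *: e + b *: v) v
       - 'd h ((1 - (2 * r) ^+ 2)%:C *: e + b *: v) v).
    by move=> hb; apply: is_deriveB; apply: is_derive_line; apply: dh; apply: in_ball.
  (* The two points are [3 r^2] apart, and on the segment joining them the derivative along it is at
     most [M / (3 r^2 / 4)] per unit length. *)
  have g_bound (b : R[i]^o) : cabs b <= 2 * (r / 4) -> cabs (g b) <= 4 * M.
    move=> hb.
    have wE (t : R) : (1 - (2 * r) ^+ 2)%:C *: e + b *: v + t%:C *: ((3 * r ^+ 2)%:C *: e)
      = (1 - (2 * r) ^+ 2 + t * (3 * r ^+ 2))%:C *: e + b *: v.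
      by rewrite scalerA -rmorphM addrAC -scalerDl -rmorphD.
    have := @mean_value_bound _ h ((1 - (2 * r) ^+ 2)%:C *: e + b *: v)
      ((3 * r ^+ 2)%:C *: e) (4 * M).
    have := wE 1; rewrite rmorph1 scale1r => ->.
    have -> : 1 - (2 * r) ^+ 2 + 1 * (3 * r ^+ 2) = 1 - r ^+ 2 by ring.
    apply => t ht; rewrite wE.
    have ht' : 0 <= 1 - (2 * r) ^+ 2 + t * (3 * r ^+ 2) <= 1 - r ^+ 2 by nra.
    have hw := in_ball _ _ ht' hb; split; first exact: dh.
    have := dhM _ ((3 * r ^+ 2)%:C *: e) hw.
    have := norm_w _ _ ht' hb.
    have -> : nrm ((3 * r ^+ 2)%:C *: e) = 3 * r ^+ 2.
      rewrite nrmZ e1 mulr1 cabs_real ger0_norm //.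
      by rewrite mulr_ge0 ?ler0n ?sqr_ge0.
    set A := 1 - _; set q := cabs _ => hA hq.
    have q0 : 0 <= q by exact: cabs_ge0.
    have r2 : 0 < 3 / 4 * r ^+ 2 by rewrite mulr_gt0 ?exprn_gt0.
    rewrite -(ler_pM2l r2); apply: le_trans (ler_wpM2r q0 hA) _; lra.
  have z0 : cabs (0 : R[i]^o) <= 2 * (r / 4) by rewrite cabs0; lra.
  have r4 : 0 < r / 4 by rewrite divr_gt0.
  have := @cauchy_estimate _ g (r / 4) (4 * M) r4 _ g_bound.
  have [_ ->] := dg 0 z0; rewrite scale0r !addr0.
  have -> : 4 * (4 * M) / (r / 4) = 64 * M / r by field; rewrite gt_eqF.
  rewrite ler_pdivlMr //; apply => z hz.
  by have [] := dg z hz.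
(* Here the point stays away from the sphere, and the hypothesis bounds the whole differential
   directly. *)
have base (r : R) : 1 / 2 < r -> r <= 1 ->
    cabs ('d h ((1 - r ^+ 2)%:C *: e) v) * r <= 128 * M.
  move=> r2 r1; set w := _ *: e.
  have wn : nrm w = 1 - r ^+ 2 by rewrite nrmZ e1 mulr1 cabs_real ger0_norm //; nra.
  have := dhM w v; rewrite wn v1 mulr1; set q := cabs _ => hq.
  have q0 : 0 <= q by exact: cabs_ge0.
  have {}hq : (1 - (1 - r ^+ 2) ^+ 2) * q <= M by apply: hq; nra.
  have r3 : 1 / 4 <= 1 - (1 - r ^+ 2) ^+ 2.
    have u1 : 1 / 4 <= r ^+ 2 by nra.
    have u2 : r ^+ 2 <= 1 by nra.
    nra.
  have : 1 / 4 * q <= M by apply: le_trans hq; rewrite ler_wpM2r.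
  nra.
(* Induction on the number of doublings. The constant 128 solves [c = 64 + c / 2]: the bound at
   [2 r] is halved on returning to [r], and the comparison adds 64. *)
have main k : forall r : R, 2 ^- k <= r -> r <= 1 ->
    cabs ('d h ((1 - r ^+ 2)%:C *: e) v) * r <= 128 * M.
  elim: k => [|k ih] r hr r1; first by apply: base => //; rewrite expr0 invr1 in hr; lra.
  have [r2|r2] := ltP (1 / 2) r; first exact: base.
  have r0 : 0 < r by apply: lt_le_trans hr; rewrite invr_gt0 exprn_gt0.
  have r21 : 2 * r <= 1 by lra.
  have h1 := step r r0 r21.
  have h2 : cabs ('d h ((1 - (2 * r) ^+ 2)%:C *: e) v) * (2 * r) <= 128 * M.
    by apply: ih => //; move: hr; rewrite exprS invfM; lra.
  set a := 'd h ((1 - r ^+ 2)%:C *: e) v in h1 *.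
  set b := 'd h ((1 - (2 * r) ^+ 2)%:C *: e) v in h1 h2.
  have : cabs a <= cabs (a - b) + cabs b by rewrite -{1}(subrK b a) ler_cabsD.
  by rewrite -(ler_pM2r r0) mulrDl; lra.
move=> r /andP[r0 r1]; have [k /ltW hk] := dyadic_small r0.
exact: main hk r1.
Qed.

End Tangential.

(** * Gradients and differentials *)

Section InnerProduct.
#[local] Existing Instance totally_filter.
Variables (R : realType) (X : completeNormedModType R[i]).
Variables (ip : {dot X for Num.conj}) (hip : induces_norm ip).

Lemma ip_self x : ip x x = (nrm x ^+ 2)%:C.
Proof. by rewrite -hip normE rmorphXn. Qed.

Lemma ip_conj x y : ip x y = (ip y x)^*.
Proof. by rewrite hermC expr0 mul1r. Qed.

Lemma ipZl (c : R[i]) x y : ip (c *: x) y = c * ip x y.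
Proof. by rewrite linearZl_LR. Qed.

Lemma ipZr (c : R[i]) x y : ip x (c *: y) = c^* * ip x y.
Proof. by rewrite linearZr_LR. Qed.

Lemma ip_pythagoras x y : ip x y = 0 -> nrm (x + y) ^+ 2 = nrm x ^+ 2 + nrm y ^+ 2.
Proof.
by move=> xy; apply: complexI; rewrite rmorphD /= -!ip_self hnormDd.
Qed.

Lemma ip_pythagorasZ (c d : R[i]) x y : ip x y = 0 ->
  nrm (c *: x + d *: y) ^+ 2 = cabs c ^+ 2 * nrm x ^+ 2 + cabs d ^+ 2 * nrm y ^+ 2.
Proof.
by move=> xy; rewrite ip_pythagoras ?ipZl ?ipZr ?xy ?mulr0 // !nrmZ !exprMn.
Qed.

Lemma proj_lineP a x : nrm x ^+ 2 =
  nrm (proj_line ip a x) ^+ 2 + nrm (x - proj_line ip a x) ^+ 2.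
Proof.
have [->|a0] := eqVneq a 0.
  by rewrite /proj_line scaler0 nrm0 expr0n add0r subr0.
rewrite -[in LHS](subrK (proj_line ip a x) x) addrC ip_pythagoras // ip_conj.
by rewrite {1}/proj_line proj_line_orthogonal // rmorph0.
Qed.

(** Projecting [x] onto the line of [y] does not increase its norm. *)
Lemma ip_cauchy_schwarz x y : cabs (ip x y) <= nrm x * nrm y.
Proof.
have [->|y0] := eqVneq y 0; first by rewrite linear0r cabs0 nrm0 mulr0.
have ny : 0 < nrm y by rewrite lt0r nrm_eq0 y0 nrm_ge0.
have : nrm (proj_line ip y x) ^+ 2 <= nrm x ^+ 2.
  by rewrite [leRHS](proj_lineP y) lerDl sqr_ge0.
rewrite ler_pXn2r ?nnegrE ?nrm_ge0 // /proj_line nrmZ cabsM cabsV ip_self.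
rewrite cabs_real ger0_norm ?sqr_ge0 // expr2 invfM mulrA divfK ?gt_eqF //.
by rewrite ler_pdivrMr.
Qed.

Variables (I : choiceType) (e : I -> X) (he : orthonormal_basis ip e).

Lemma ip_orthonormal_sum (s : seq I) (a b : I -> R[i]) : uniq s ->
  ip (\sum_(i <- s) a i *: e i) (\sum_(i <- s) b i *: e i)
  = \sum_(i <- s) a i * (b i)^*.
Proof.
move=> us; rewrite linear_sumlz; apply: eq_big_seq => i si.
rewrite linearZl_LR; congr (_ * _); rewrite linear_sumr (bigD1_seq i) //= ipZr he.1 eqxx mulr1.
rewrite big1 ?addr0 // => j ji; rewrite ipZr he.1 eq_sym (negbTE ji) mulr0 //.
Qed.

Lemma nrm_orthonormal_sum (s : seq I) (a : I -> R[i]) : uniq s ->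
  nrm (\sum_(i <- s) a i *: e i) ^+ 2 = \sum_(i <- s) cabs (a i) ^+ 2.
Proof.
move=> us; apply: complexI; rewrite -ip_self ip_orthonormal_sum // rmorph_sum.
by apply: eq_bigr => i _; rewrite rmorphXn /= -cabsE sqr_normc.
Qed.

Lemma partial_sumE (V : zmodType) (F : I -> V) (A : {fset I}) :
  partial_sum F A = \sum_(i <- A) F i.
Proof. by rewrite /partial_sum big_seq_fsetE. Qed.

Lemma big_fset_split (V : nmodType) (F : I -> V) (A B : {fset I}) : (A `<=` B)%fset ->
  \sum_(i <- B) F i = \sum_(i <- A) F i + \sum_(i <- (B `\` A)%fset) F i.
Proof.
move=> AB; rewrite (big_fsetID _ (mem A)) /=; congr (_ + _); apply: eq_fbigl => i.
  by rewrite !inE /= andb_idl // => /(fsubsetP AB).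
by rewrite !inE /= andbC.
Qed.

(** * The vector of coefficients of a bounded functional *)

Variables (L : {linear X -> R[i]^o}) (K : R).
Hypotheses (K0 : 0 <= K) (hL : forall x, cabs (L x) <= K * nrm x).

Let c (i : I) : R[i] := L (e i).
(** As in [gradient], the coefficients are not conjugated: the limit is the coordinatewise conjugate
    of the Riesz vector of [L]. *)
Let gs (A : {fset I}) : X := \sum_(i <- A) c i *: e i.
Let S (A : {fset I}) : R := \sum_(i <- A) cabs (c i) ^+ 2.

Lemma nrm_functional_sum (A : {fset I}) : nrm (gs A) <= K.
Proof.
have gS : nrm (gs A) ^+ 2 = S A by apply: nrm_orthonormal_sum; exact: fset_uniq.
(* Testing [L] on [y] gives [|gs A|^2 = L y <= K |gs A|]. *)
pose y : X := \sum_(i <- A) (c i)^* *: e i.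
have yS : nrm y ^+ 2 = S A.
  rewrite nrm_orthonormal_sum ?fset_uniq //.
  by apply: eq_bigr => i _; rewrite cabs_conj.
have Ly : L y = (S A)%:C.
  rewrite linear_sum rmorph_sum; apply: eq_bigr => i _.
  by rewrite linearZ rmorphXn /= -cabsE sqr_normc mulrC.
have SA0 : 0 <= S A by rewrite -gS sqr_ge0.
have := hL y; rewrite Ly cabs_real ger0_norm // -gS.
have -> : nrm y = nrm (gs A).
  by apply/eqP; rewrite -(@eqrXn2 _ 2) ?nrm_ge0 // yS gS.
have [->//|g0] := eqVneq (nrm (gs A)) 0.
by rewrite expr2 ler_pM2r // lt0r g0 nrm_ge0.
Qed.

(** The sums [S A] are bounded by [K ^+ 2]. Past a finite set [A0] that nearly attains their
    supremum, the added terms have squared norm [S A - S A0], which is small, so the net is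
    Cauchy. *)
Lemma cvg_functional_sum : partial_sum (fun i => c i *: e i) @ totally -->
  sum (fun i => c i *: e i).
Proof.
have FF : ProperFilter (partial_sum (fun i => c i *: e i) @ totally).
  exact: fmap_proper_filter.
apply: cauchy_cvg; apply: (@cauchy_exP R[i] X _ (@filter_filter _ _ FF)) => eps /gt0_complex[d d0 ->].
pose U := [set S A | A in [set: {fset I}]].
have SK A : S A <= K ^+ 2.
  rewrite /S -nrm_orthonormal_sum ?fset_uniq //.
  by rewrite ler_pXn2r ?nnegrE ?nrm_ge0 // nrm_functional_sum.
have supU : has_sup U.
  by split; [exists (S fset0), fset0|exists (K ^+ 2) => _ [A _ <-]].
have d2 : 0 < d ^+ 2 by rewrite exprn_gt0.
have [_ [A0 _ <-] hA0] := sup_adherent d2 supU.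
exists (gs A0), A0 => //= A A0A.
rewrite -ball_normE /ball_ /= partial_sumE distrC normc_lt.
rewrite (big_fset_split _ A0A) addrC addKr.
rewrite -(@ltr_pXn2r _ 2) ?nnegrE ?nrm_ge0 ?ltW // nrm_orthonormal_sum ?fset_uniq //.
have SAU : S A <= sup U by apply: ub_le_sup; [exact: supU.2|exists A].
by move: SAU; rewrite /S (big_fset_split _ A0A) -/(S A0); lra.
Qed.

Let g := sum (fun i => c i *: e i).

Lemma near_functional_sum (d : R) : 0 < d -> \forall A \near totally, nrm (g - gs A) < d.
Proof.
move=> d0; have dc : 0 < d%:C by rewrite ltcR.
have /cvgrPdist_lt/(_ _ dc) := cvg_functional_sum.
by apply: filterS => A; rewrite normc_lt partial_sumE.
Qed.

Lemma nrm_functional_gradient_le : nrm g <= K.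
Proof.
apply/ler_addgt0Pr => d d0.
have [A hA] := filter_ex (near_functional_sum d0).
rewrite -(subrK (gs A) g) addrC (le_trans (ler_nrmD _ _)) //.
by apply: lerD; [exact: nrm_functional_sum|exact: ltW].
Qed.

(** On a finite partial sum of [x], [L] is the inner product of [gs A] with the vector of conjugate
    coordinates, and Cauchy-Schwarz applies. A common finite set [A] approximates both [g] and
    [x]. *)
Lemma functional_le_gradient x : cabs (L x) <= nrm g * nrm x.
Proof.
suff h (eps : R) : 0 < eps -> cabs (L x) <= nrm g * nrm x + eps.
  by apply/ler_addgt0Pr.
(* For [d <= 1], replacing [g] and [x] by approximations within [d] costs at most [d * T] in
   total. *)
move=> eps0; pose T := nrm g + nrm x + 1 + K.
have T0 : 0 < T by rewrite /T addrAC ltr_wpDl ?ltr01 ?addr_ge0 ?nrm_ge0.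
pose d := Num.min 1 (eps / T).
have d0 : 0 < d by rewrite lt_min ltr01 divr_gt0.
have d1 : d <= 1 by rewrite ge_min lexx.
have dT : d * T <= eps by rewrite -ler_pdivlMr // ge_min lexx orbT.
have near_x : \forall A \near totally, nrm (x - \sum_(i <- (A : {fset I})) ip x (e i) *: e i) < d.
  have dc : 0 < d%:C by rewrite ltcR.
  have /cvgrPdist_lt/(_ _ dc) := he.2 x.
  by apply: filterS => A; rewrite normc_lt partial_sumE.
have [A [hgA hxA]] := filter_ex (filterI (near_functional_sum d0) near_x).
set xA := \sum_(i <- A) _ in hxA.
pose yA : X := \sum_(i <- A) (ip x (e i))^* *: e i.
have LxA : L xA = ip (gs A) yA.
  rewrite ip_orthonormal_sum ?fset_uniq // linear_sum; apply: eq_bigr => i _.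
  by rewrite linearZ /= conjCK mulrC.
have yx : nrm yA = nrm xA.
  apply/eqP; rewrite -(@eqrXn2 _ 2) ?nrm_ge0 // !nrm_orthonormal_sum ?fset_uniq //.
  by apply/eqP; apply: eq_bigr => i _; rewrite cabs_conj.
have h1 : cabs (L x) <= cabs (L xA) + K * d.
  rewrite -[in leLHS](subrK xA x) linearD addrC (le_trans (ler_cabsD _ _)) // lerD2l.
  by rewrite (le_trans (hL _)) // ler_wpM2l // ltW.
have h2 : cabs (L xA) <= nrm (gs A) * nrm xA.
  by rewrite LxA -yx ip_cauchy_schwarz.
have h3 : nrm (gs A) <= nrm g + d.
  rewrite -[gs A](subrK g) addrC (le_trans (ler_nrmD _ _)) // lerD2l.
  by rewrite -nrmN opprB ltW.
have h4 : nrm xA <= nrm x + d.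
  rewrite -[xA](subrK x) addrC (le_trans (ler_nrmD _ _)) // lerD2l.
  by rewrite -nrmN opprB ltW.
have h5 : nrm (gs A) * nrm xA <= (nrm g + d) * (nrm x + d).
  by apply: ler_pM; rewrite ?nrm_ge0.
have dd : d * d <= d by rewrite ler_piMr // ltW.
have h6 : (nrm g + d) * (nrm x + d) + K * d <= nrm g * nrm x + d * T.
  have -> : (nrm g + d) * (nrm x + d) + K * d
    = nrm g * nrm x + d * (T - 1) + d * d by rewrite /T; ring.
  by rewrite -addrA lerD2l mulrBr mulr1; lra.
lra.
Qed.

End InnerProduct.

(** * Gradient norms and operator norms of differentials *)

Section DualAndGradient.
Variables (R : realType) (X Y : completeNormedModType R[i]).

(* [sup] is 0 on unbounded sets, so [dual_norm u = 1] forces boundedness. *)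
Lemma unit_dual_le (u : {linear Y -> R[i]^o}) y : unit_dual u -> cabs (u y) <= nrm y.
Proof.
move=> [_]; rewrite /dual_norm; set U := [set _ | _ in _] => u1.
have hU : has_sup U.
  by apply: contrapT => /sup_out U0; have := oner_neq0 R; rewrite -u1 U0 eqxx.
have [->|y0] := eqVneq y 0; first by rewrite linear0 cabs0 nrm_ge0.
have ny : 0 < nrm y by rewrite lt0r nrm_eq0 y0 nrm_ge0.
have : U (nrm (u ((nrm y)^-1%:C *: y))).
  exists ((nrm y)^-1%:C *: y) => //=.
  by rewrite nrmZ cabs_real ger0_norm ?invr_ge0 ?nrm_ge0 // mulVf ?gt_eqF.
move/(ub_le_sup hU.2); rewrite u1 linearZ /= nrmZ cabs_real.
by rewrite ger0_norm ?invr_ge0 ?nrm_ge0 // ler_pdivrMl // mulr1.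
Qed.

Lemma differential_bound (V W : normedModType R[i]) (f : V -> W) z :
  differentiable f z -> exists2 k : R, 0 <= k & forall x, nrm ('d f z x) <= k * nrm x.
Proof.
move=> df; have [_ /gt0_complex[k k0 ->] hk] := linear_lipschitz (diff_continuous df).
by exists k; [exact: ltW|move=> x; have := hk x; rewrite !normE -rmorphM lecR].
Qed.

Lemma diff_dual (f : X -> Y) z (u : {linear Y -> R[i]^o}) :
  continuous u -> differentiable f z ->
  differentiable (u \o f) z /\ 'd (u \o f) z = u \o 'd f z :> (X -> R[i]^o).
Proof.
move=> cu df; have du : differentiable u (f z) by exact: linear_differentiable.
by split; [exact: differentiable_comp|rewrite diff_comp // diff_lin].
Qed.

Variables (ip : {dot X for Num.conj}) (hip : induces_norm ip).
Variables (I : choiceType) (e : I -> X) (he : orthonormal_basis ip e).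

Lemma gradientE (h : X -> R[i]^o) z : differentiable h z ->
  gradient e h z = sum (fun k => ('d h z (e k) : R[i]) *: e k).
Proof.
by move=> dh; rewrite /gradient; congr sum; apply/funext => k; rewrite deriveE.
Qed.

(** Together with [differential_le_gradient], this makes the norm of the gradient the operator norm
    of the differential. *)
Lemma nrm_gradient_le (h : X -> R[i]^o) z (K : R) : differentiable h z -> 0 <= K ->
  (forall x, cabs ('d h z x) <= K * nrm x) -> nrm (gradient e h z) <= K.
Proof.
by move=> dh K0 hK; rewrite gradientE //; exact: (nrm_functional_gradient_le hip he K0 hK).
Qed.

Lemma differential_le_gradient (h : X -> R[i]^o) z x : differentiable h z ->
  cabs ('d h z x) <= nrm (gradient e h z) * nrm x.
Proof.
move=> dh; have [k k0 hk] := differential_bound dh; rewrite gradientE //.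
exact: (functional_le_gradient hip he k0 hk).
Qed.

Lemma gradient_norm_le (f : X -> Y) z (K : R) : 0 <= K ->
  (forall u : {linear Y -> R[i]^o}, unit_dual u -> nrm (gradient e (u \o f) z) <= K) ->
  gradient_norm e f z <= K.
Proof.
move=> K0 hK; rewrite /gradient_norm; set S := (X in sup X).
(* Without unit functionals, as for [Y = {0}], the supremum is 0 by convention; this case uses
   [0 <= K]. *)
have [S0|/set0P SN0] := eqVneq S set0; first by rewrite S0 sup0.
by apply: ge_sup => // _ [u hu <-]; exact: hK.
Qed.

(** The operator norm of ['d f z] bounds the set, so its [sup] is a true upper bound and not the
    default 0. *)
Lemma le_gradient_norm (f : X -> Y) z (u : {linear Y -> R[i]^o}) :
  differentiable f z -> unit_dual u ->
  nrm (gradient e (u \o f) z) <= gradient_norm e f z.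
Proof.
move=> df hu; have [k k0 hk] := differential_bound df.
apply: ub_le_sup; last by exists u.
exists k => _ [v hv <-]; have [dv dvE] := diff_dual hv.1 df.
apply: nrm_gradient_le => // x; rewrite dvE /=.
exact: le_trans (unit_dual_le _ hv) (hk x).
Qed.

Lemma gradient_norm_ge0 (f : X -> Y) z : 0 <= gradient_norm e f z.
Proof.
rewrite /gradient_norm; set S := (X in sup X).
have [hS|/sup_out -> //] := pselect (has_sup S).
have [[_ [u hu _]] hub] := hS.
by apply: le_trans (nrm_ge0 _) (ub_le_sup hub _); exists u.
Qed.

End DualAndGradient.

(** * The differential of a Moebius transformation at 0 *)

Section Mobius.
Variables (R : realType) (X : completeNormedModType R[i]).
Variables (ip : {dot X for Num.conj}) (hip : induces_norm ip).

(** Converse of [diff_expansion]. The bound by [k] makes [D] continuous, as uniqueness of the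
    differential demands. *)
Lemma is_diff_expansion (V W : normedModType R[i]) (f : V -> W) (z : V)
    (D : {linear V -> W}) (k : R) :
  (forall x, nrm (D x) <= k * nrm x) ->
  (forall e : R, 0 < e -> exists2 d : R, 0 < d &
    forall y, nrm y < d -> nrm (f (z + y) - f z - D y) <= e * nrm y) ->
  differentiable f z /\ 'd f z = D :> (V -> W).
Proof.
move=> hk hf.
have cD : continuous D.
  apply/linear_bounded_continuous/bounded_funP => r; exists (`|k|%:C * r) => x xr.
  apply: (@le_trans _ _ (`|k|%:C * `|x|)); last by rewrite ler_wpM2l // ler0c.
  rewrite !normE -rmorphM lecR (le_trans (hk x)) // ler_wpM2r ?nrm_ge0 //.
  exact: ler_norm.
have fE : f \o shift z = cst (f z) + D +o_ 0 id.
  apply/eqaddoP => _ /gt0_complex[eps eps0 ->]; apply/near_nrm.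
  have [d d0 hd] := hf eps eps0; exists d => // y; rewrite subr0 => yd.
  have := hd y yd; rewrite !normE -rmorphM lecR !fctE /= opprD addrA.
  by rewrite (addrC y z).
have dE := diff_unique cD fE.
split=> //; apply/diff_locallyP; rewrite dE; split => //.
Qed.

(* Since [proj_line ip 0 x = 0], this is [- x] for [a = 0]. *)
Definition mobius_diff (a x : X) : X :=
  let s := Num.sqrt (1 - nrm a ^+ 2) in
  - ((s ^+ 2)%:C *: proj_line ip a x + s%:C *: (x - proj_line ip a x)).

Lemma proj_line_is_linear a : linear (proj_line ip a).
Proof.
move=> c x y; rewrite /proj_line linearDl linearZl_LR /= mulrDl -mulrA.
by rewrite scalerDl scalerA.
Qed.

HB.instance Definition _ a := GRing.isLinear.Build R[i] X X *:%R (proj_line ip a)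
  (proj_line_is_linear a).

Lemma mobius_diff_is_linear a : linear (mobius_diff a).
Proof.
move=> c x y; rewrite /mobius_diff.
have -> : proj_line ip a (c *: x + y) = c *: proj_line ip a x + proj_line ip a y.
  exact: linearP.
rewrite scalerN -opprD; congr (- _).
rewrite opprD (addrACA (c *: x)) -scalerBr.
move: (proj_line ip a x) (proj_line ip a y) (x - _) (y - _) => P1 P2 Q1 Q2.
rewrite !scalerDr !scalerA ![c * _]mulrC.
by rewrite addrACA.
Qed.

HB.instance Definition _ a := GRing.isLinear.Build R[i] X X *:%R (mobius_diff a)
  (mobius_diff_is_linear a).

Lemma ip_proj_line a x : ip (x - proj_line ip a x) (proj_line ip a x) = 0.
Proof.
have [->|a0] := eqVneq a 0; first by rewrite /proj_line scaler0 linear0r.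
by rewrite {2}/proj_line proj_line_orthogonal.
Qed.

Lemma mobius_scale_bound (a : X) : nrm a < 1 ->
  let s := Num.sqrt (1 - nrm a ^+ 2) in
  [/\ 0 < s, s <= 1 & s ^+ 2 = 1 - nrm a ^+ 2].
Proof.
move=> a1 s; have na := nrm_ge0 a.
have s2 : 0 < 1 - nrm a ^+ 2 by nra.
have s2E : s ^+ 2 = 1 - nrm a ^+ 2 by rewrite sqr_sqrtr // ltW.
have s0 : 0 < s by rewrite sqrtr_gt0.
by split=> //; rewrite -[leRHS]sqrtr1 ler_wsqrtr // gerBl sqr_ge0.
Qed.

(** The orthogonal components are scaled by [s^2] and [s], both at most 1. *)
Lemma nrm_mobius_diff a x : nrm a < 1 -> nrm (mobius_diff a x) <= nrm x.
Proof.
move=> a1; have [s0 s1 _] := mobius_scale_bound a1.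
rewrite /mobius_diff nrmN addrC; move: (Num.sqrt _) s0 s1 => s s0 s1.
rewrite -(@ler_pXn2r _ 2) ?nnegrE ?nrm_ge0 //.
rewrite (ip_pythagorasZ hip) ?ip_proj_line // !cabs_real !real_normK ?num_real //.
rewrite (proj_lineP hip a x) addrC; apply: lerD; rewrite ler_piMl ?sqr_ge0 //.
  by rewrite -exprM exprn_ile1 // ltW.
by rewrite exprn_ile1 // ltW.
Qed.

Lemma mobius0 a : mobius ip a 0 = a.
Proof.
rewrite /mobius; case: eqVneq => [->|_]; first by rewrite oppr0.
by rewrite linear0 linear0l !subr0 scaler0 subr0 invr1 scale1r.
Qed.

(** An exact remainder, quadratic in [y]. For [a != 0] and [l = ip y a], the identity
    [l a = |a|^2 P y] turns [mobius_diff a y] into [l a - P y - s Q y], while the transformation is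
    [(a - P y - s Q y) / (1 - l)]. *)
Lemma mobius_expansion a y : nrm a < 1 -> ip y a != 1 ->
  mobius ip a y - a - mobius_diff a y = (ip y a / (1 - ip y a)) *: mobius_diff a y.
Proof.
move=> a1 l1; have [s0 s1 s2E] := mobius_scale_bound a1.
rewrite /mobius; case: eqVneq => [->|a0].
  by rewrite /mobius_diff /proj_line !scaler0 !linear0r mul0r scale0r nrm0 expr0n
     !subr0 sqrtr1 scale1r add0r subrr.
rewrite /mobius_diff; set s := Num.sqrt _ in s0 s1 s2E *; set l := ip y a.
set P := proj_line ip a y; set Q := y - P.
have laE : l *: a = (nrm a ^+ 2)%:C *: P.
  rewrite -(ip_self hip) /P /proj_line scalerA mulrCA mulfV ?mulr1 //.
  by rewrite gt_eqF // neq0_dnorm_gt0.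
have -> : - ((s ^+ 2)%:C *: P + s%:C *: Q) = l *: a + (- P - s%:C *: Q).
  by rewrite s2E rmorphB rmorph1 scalerBl scale1r laE !opprD opprK -addrA addrCA addrA.
have -> : a - P - s%:C *: Q = a + (- P - s%:C *: Q) by rewrite addrA.
move: (- P - _) => W.
have l0 : 1 - l != 0 by rewrite subr_eq0 eq_sym.
transitivity (((1 - l)^-1 - 1 - l) *: a + ((1 - l)^-1 - 1) *: W).
  by rewrite !scalerBl !scale1r scalerDr opprD (addrAC (_ *: a)) addrACA.
by rewrite scalerDr scalerA; congr (_ *: _ + _ *: _); field.
Qed.

Lemma mobius_is_diff a : nrm a < 1 ->
  differentiable (mobius ip a) 0 /\ 'd (mobius ip a) 0 = mobius_diff a :> (X -> X).
Proof.
move=> a1; apply: (@is_diff_expansion _ _ _ _ _ 1) => [x|eps eps0].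
  by rewrite mul1r nrm_mobius_diff.
(* The first bound gives [|1 - ip y a| >= 1 / 2]; the second then makes the factor of the remainder
   at most [eps]. *)
exists (Num.min (1 / 2) (eps / 2)); first by rewrite lt_min !divr_gt0.
move=> y; rewrite lt_min => /andP[y1 y2]; rewrite add0r mobius0.
have ly : cabs (ip y a) <= nrm y.
  by rewrite (le_trans (ip_cauchy_schwarz hip _ _)) // ler_piMr ?nrm_ge0 // ltW.
have l1 : ip y a != 1.
  by apply: contraTneq ly => ->; rewrite cabs1 -ltNge; lra.
rewrite mobius_expansion // nrmZ cabsM cabsV.
have k2 : 1 / 2 <= cabs (1 - ip y a).
  have := ler_cabsD (1 - ip y a) (ip y a); rewrite subrK cabs1; lra.
apply: ler_pM; rewrite ?mulr_ge0 ?invr_ge0 ?cabs_ge0 ?nrm_ge0 ?nrm_mobius_diff //.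
by rewrite ler_pdivrMr; nra.
Qed.

End Mobius.

(** * Comparison of the two seminorms *)

Section Comparison.
Variables (R : realType) (X Y : completeNormedModType R[i]).
Variables (ip : {dot X for Num.conj}) (hip : induces_norm ip).
Variables (I : choiceType) (e : I -> X) (he : orthonormal_basis ip e).

(* The witness is [s ^+ 2] times the preimage of [y], that is [- (P y + s Q y)]. *)
Lemma mobius_diff_section a y : nrm a < 1 ->
  exists2 x, mobius_diff ip a x = (1 - nrm a ^+ 2)%:C *: y & nrm x <= nrm y.
Proof.
move=> a1; have [s0 s1 s2E] := mobius_scale_bound a1.
rewrite /mobius_diff; move: (Num.sqrt _) s0 s1 s2E => s s0 s1 <-.
have PP x : proj_line ip a (proj_line ip a x) = proj_line ip a x.
  rewrite /proj_line; have [->|a0] := eqVneq a 0; first by rewrite !scaler0.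
  rewrite linearZl_LR /= mulfK //.
  by rewrite gt_eqF // neq0_dnorm_gt0.
pose x := - (proj_line ip a y + s%:C *: (y - proj_line ip a y)).
have Px : proj_line ip a x = - proj_line ip a y.
  rewrite /x (linearN (proj_line ip a)) (linearD (proj_line ip a)) /= PP.
  rewrite (linearZ_LR (proj_line ip a)) /= (linearB (proj_line ip a)) /= PP.
  by rewrite subrr scaler0 addr0.
exists x.
  rewrite Px; have -> : x - - proj_line ip a y = - (s%:C *: (y - proj_line ip a y)).
    by rewrite /x opprK opprD addrAC addNr add0r.
  rewrite !scalerN -opprD opprK (scalerA s%:C) -rmorphM -expr2 -scalerDr.
  by rewrite addrC subrK.
rewrite /x nrmN addrC -[X in nrm (_ + X)]scale1r.
rewrite -(@ler_pXn2r _ 2) ?nnegrE ?nrm_ge0 //.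
rewrite (ip_pythagorasZ hip) ?ip_proj_line // cabs1 cabs_real real_normK ?num_real //.
rewrite expr1n mul1r (proj_lineP hip a y) addrC lerD2l ler_piMl ?sqr_ge0 //.
by rewrite exprn_ile1 // ltW.
Qed.

Lemma tangential_vector (h : X -> R[i]^o) (a x : X) (M : R) :
  (forall w, nrm w < 1 -> differentiable h w) ->
  (forall w x, nrm w < 1 -> (1 - nrm w ^+ 2) * cabs ('d h w x) <= M * nrm x) ->
  nrm a < 1 -> a != 0 -> ip x a = 0 ->
  Num.sqrt (1 - nrm a ^+ 2) * cabs ('d h a x) <= 256 * M * nrm x.
Proof.
move=> dh hM a1 a0 xa.
have [->|x0] := eqVneq x 0; first by rewrite linear0 cabs0 nrm0 !mulr0.
have na : 0 < nrm a by rewrite lt0r nrm_eq0 a0 nrm_ge0.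
have nx : 0 < nrm x by rewrite lt0r nrm_eq0 x0 nrm_ge0.
pose e0 := (nrm a)^-1%:C *: a; pose v := (nrm x)^-1%:C *: x.
have pyth (c d : R[i]) : nrm (c *: e0 + d *: v) ^+ 2 = cabs c ^+ 2 + cabs d ^+ 2.
  rewrite (ip_pythagorasZ hip); last first.
    by rewrite linearZl_LR linearZr_LR /= ip_conj xa rmorph0 !mulr0.
  rewrite !nrmZ !cabs_real !gtr0_norm ?invr_gt0 // !mulVf ?gt_eqF //.
  by rewrite !expr1n !mulr1.
(* Chosen so that [1 - r^2 = |a|]. Since [1 - |a|^2 <= 2 r^2], passing from [r] to the square root
   of [1 - |a|^2] costs at most a factor 2, whence 256. *)
pose r := Num.sqrt (1 - nrm a).
have r2 : r ^+ 2 = 1 - nrm a by rewrite sqr_sqrtr // subr_ge0 ltW.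
have r0 : 0 < r by rewrite sqrtr_gt0 subr_gt0.
have r1 : r <= 1 by rewrite -[leRHS]sqrtr1 ler_wsqrtr // gerBl ltW.
have := @tangential_bound _ _ h e0 v M pyth dh hM r.
rewrite r0 r1 r2 subKr scalerA -rmorphM mulfV ?gt_eqF // scale1r => /(_ isT).
rewrite linearZ /= cabsM cabs_real gtr0_norm ?invr_gt0 //.
rewrite -ler_pdivlMr // mulrC ler_pdivrMr // => {}hq.
have hs : Num.sqrt (1 - nrm a ^+ 2) <= 2 * r.
  rewrite -(@ler_pXn2r _ 2) ?nnegrE ?sqrtr_ge0 ?mulr_ge0 ?ltW //.
  by rewrite exprMn r2 sqr_sqrtr; nra.
apply: le_trans (ler_wpM2r (cabs_ge0 _) hs) _.
have -> : 256 * M * nrm x = 2 * r * (128 * M / r * nrm x) by field; rewrite gt_eqF.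
by rewrite ler_pM2l // mulr_gt0.
Qed.

(** The constant is 1 + 256: the factor [s^2] on the radial part matches the Bloch bound, the factor
    [s] on the tangential part matches [tangential_vector]. *)
Lemma mobius_diff_bound (h : X -> R[i]^o) (a x : X) (M : R) :
  (forall w, nrm w < 1 -> differentiable h w) ->
  (forall w x, nrm w < 1 -> (1 - nrm w ^+ 2) * cabs ('d h w x) <= M * nrm x) ->
  0 <= M -> nrm a < 1 -> cabs ('d h a (mobius_diff ip a x)) <= 257 * M * nrm x.
Proof.
move=> dh hM M0 a1; have [s0 s1 s2E] := mobius_scale_bound a1.
have [Pn Qn] : nrm (proj_line ip a x) <= nrm x /\ nrm (x - proj_line ip a x) <= nrm x.
  by split; rewrite -(@ler_pXn2r _ 2) ?nnegrE ?nrm_ge0 // (proj_lineP hip a x)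
    ?lerDl ?lerDr sqr_ge0.
have Qa : a != 0 -> ip (x - proj_line ip a x) a = 0.
  by move=> a0; have := proj_line_orthogonal ip x a0 1; rewrite scale1r.
rewrite /mobius_diff; move: (proj_line ip a x) (x - _) Pn Qn Qa => P Q Pn Qn Qa.
have hPn : M * nrm P <= M * nrm x by rewrite ler_wpM2l.
have hQn : M * nrm Q <= M * nrm x by rewrite ler_wpM2l.
have hP := hM _ P a1; rewrite -s2E in hP.
have hQ : Num.sqrt (1 - nrm a ^+ 2) * cabs ('d h a Q) <= 256 * M * nrm Q.
  (* At the origin [s = 1], and the Bloch bound already controls every direction. *)
  have [a0|a0] := eqVneq a 0; last exact: tangential_vector dh hM a1 a0 (Qa a0).
  have := hM _ Q a1; rewrite a0 nrm0 expr0n subr0 sqrtr1 => /le_trans; apply.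
  by rewrite -mulrA ler_peMl ?mulr_ge0 ?nrm_ge0 // ler1n.
move: (Num.sqrt _) s0 hP hQ {s1 s2E} => s s0 hP hQ.
rewrite linearN cabsN linearD; apply: le_trans (ler_cabsD _ _) _.
rewrite !linearZ !cabsM !cabs_real ger0_norm ?sqr_ge0 // gtr0_norm //.
lra.
Qed.

(** For each [y], [mobius_diff_section] gives [x] no longer than [y] that the differential of the
    Moebius map sends to [(1 - |z|^2) y]; evaluate the differential of the composite at [x]. *)
Lemma bloch_pointwise_lower (f : X -> Y) z : differentiable f z -> nrm z < 1 ->
  (1 - nrm z ^+ 2) * gradient_norm e f z <= inv_gradient_norm e ip f z.
Proof.
move=> df z1; have [s0 _ s2E] := mobius_scale_bound z1.
have c0 : 0 < 1 - nrm z ^+ 2 by rewrite -s2E exprn_gt0.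
have [dm dmE] := mobius_is_diff hip z1.
have df' : differentiable f (mobius ip z 0) by rewrite mobius0.
have dfm : differentiable (f \o mobius ip z) 0 by exact: differentiable_comp.
rewrite mulrC -ler_pdivlMr //; apply: gradient_norm_le.
  by rewrite divr_ge0 ?(ltW c0) // gradient_norm_ge0.
move=> u hu; have [du duE] := diff_dual hu.1 df.
apply: (nrm_gradient_le hip he) => //.
  by rewrite divr_ge0 ?(ltW c0) // gradient_norm_ge0.
move=> y; rewrite mulrAC ler_pdivlMr //.
have [x xE xy] := mobius_diff_section y z1.
have [dum dumE] := diff_dual hu.1 dfm.
have := differential_le_gradient hip he x dum.
rewrite dumE /= diff_comp //= dmE mobius0 xE linearZ /= linearZ /= cabsM cabs_real.
rewrite gtr0_norm // duE /= mulrC => /le_trans; apply.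
apply: ler_pM; rewrite ?nrm_ge0 //.
exact: (le_gradient_norm hip he dfm hu).
Qed.

(** By the chain rule, this is [mobius_diff_bound] for [u \o f], with one [M] for all unit
    functionals [u]. *)
Lemma bloch_pointwise_upper (f : X -> Y) z (M : R) : holomorphic_on_ball f ->
  (forall w, nrm w < 1 -> (1 - nrm w ^+ 2) * gradient_norm e f w <= M) ->
  nrm z < 1 -> inv_gradient_norm e ip f z <= 257 * M.
Proof.
move=> hf hM z1; have [dm dmE] := mobius_is_diff hip z1.
have M0 : 0 <= M.
  have := hM 0; rewrite nrm0 ltr01 expr0n subr0 mul1r => /(_ isT).
  by apply: le_trans; exact: gradient_norm_ge0.
have df' : differentiable f (mobius ip z 0) by rewrite mobius0; exact: hf.
have dfm : differentiable (f \o mobius ip z) 0 by exact: differentiable_comp.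
apply: gradient_norm_le => [|u hu]; first by rewrite mulr_ge0 ?ler0n.
have [dum dumE] := diff_dual hu.1 dfm.
apply: (nrm_gradient_le hip he dum) => [|x]; first by rewrite mulr_ge0 ?ler0n.
have [du duE] := diff_dual hu.1 (hf z z1).
have -> : 'd (u \o (f \o mobius ip z)) 0 x = 'd (u \o f) z (mobius_diff ip z x).
  by rewrite dumE /= (diff_comp dm df') /= dmE mobius0 duE.
apply: mobius_diff_bound => // w; first by move=> w1; have [] := diff_dual hu.1 (hf w w1).
move=> y w1; have [duw _] := diff_dual hu.1 (hf w w1).
have w0 : 0 <= 1 - nrm w ^+ 2 by have := nrm_ge0 w; nra.
apply: le_trans (ler_wpM2l w0 (differential_le_gradient hip he y duw)) _.
rewrite mulrA ler_wpM2r ?nrm_ge0 //; apply: le_trans (hM w w1).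
by rewrite ler_wpM2l // (le_gradient_norm hip he (hf w w1) hu).
Qed.

End Comparison.

Theorem theorem4p9 (R : realType) (X Y : completeNormedModType R[i])
    (ip : {dot X for Num.conj}) (hip : induces_norm ip)
    (Gamma : choiceType) (e : Gamma -> X) (he : orthonormal_basis ip e) :
  bloch_nabla Y e = bloch_inv Y e ip /\
  exists C : R, 0 < C /\
    forall f : X -> Y, bloch_nabla Y e f ->
      bloch_nabla_norm e f <= bloch_inv_norm e ip f /\
      bloch_inv_norm e ip f <= C * bloch_nabla_norm e f.
Proof.
have ball0 : unit_ball (0 : X) by rewrite /unit_ball /= nrm0.
have lower (f : X -> Y) M : holomorphic_on_ball f ->
    ubound (inv_values e ip f) M -> ubound (bloch_values e f) M.
  move=> hf hM _ [z z1 <-]; apply: le_trans (bloch_pointwise_lower hip he (hf z z1) z1) _.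
  by apply: hM; exists z.
have upper (f : X -> Y) M : holomorphic_on_ball f ->
    ubound (bloch_values e f) M -> ubound (inv_values e ip f) (257 * M).
  move=> hf hM _ [z z1 <-]; apply: (bloch_pointwise_upper hip he hf) => // w w1.
  by apply: hM; exists w.
split.
  apply/seteqP; split=> f [hf [M hM]]; split=> //.
    by exists (257 * M); exact: upper.
  by exists M; exact: lower.
exists 257; split=> [|f [hf hB]]; first by rewrite ltr0n.
(* Both sets of values are bounded and nonempty, so their suprema are least upper bounds and can
   serve as [M] in [lower] and [upper]. *)
have hI : has_ubound (inv_values e ip f).
  by have [M hM] := hB; exists (257 * M); exact: upper.
have B0 : bloch_values e f !=set0 by exists ((1 - nrm (0 : X) ^+ 2) * gradient_norm e f 0), 0.
have I0 : inv_values e ip f !=set0 by exists (inv_gradient_norm e ip f 0), 0.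
split; first by rewrite lerD2l ge_sup //; apply: lower => //; exact: ub_le_sup.
rewrite /bloch_inv_norm /bloch_nabla_norm mulrDr; apply: lerD.
  by rewrite ler_peMl ?nrm_ge0 // ler1n.
by rewrite ge_sup //; apply: upper => //; exact: ub_le_sup.
Qed.
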